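(* Let $X$ be a compact metric space, $\Lambda$ a topological space, and let the parametrized dynamical system $\varphi_*\colon\Lambda\to\mathbf{DS}(\mathbb T,X)$ be stable (i.e. stable at every point of $\Lambda$). Then the attractor sheaf $\mathcal A^{\varphi_*}$ and the free attractor sheaf $\mathcal A\mathit{tt}^{\varphi_*}$ are locally constant sheaves on $\Lambda$.
   Context: Time space: $\mathbb T\in\{\mathbb Z,\mathbb Z^+,\mathbb R,\mathbb R^+\}$ with the usual topology. A dynamical system on $X$ is a continuous map $\phi\colon\mathbb T\times X\to X$ with $\phi(0,x)=x$ and $\phi(t,\phi(s,x))=\phi(t+s,x)$; $\phi_t=\phi(t,\cdot)$. $\mathbf{DS}(\mathbb T,X)$ is the set of dynamical systems with the compact-open topology. Attractors: $\omega_\phi(U)=\bigcap_{t\ge0}\mathrm{cl}\bigcup_{s\ge t}\phi_s(U)$; $U\subset X$ is an attracting neighborhood ($U\in\mathsf{ANbhd}(\phi)$) if $\omega_\phi(U)\subset\mathrm{int}\,U$; an attractor is a set $A=\omega_\phi(U)$ with $U\in\mathsf{ANbhd}(\phi)$. The set $\mathsf{Att}(\phi)$ of attractors is a bounded distributive lattice with $A\vee A'=A\cup A'$, $A\wedge A'=\omega_\phi(A\cap A')$, bottom $\emptyset$, top $\omega_\phi(X)$. Parametrized dynamical system over $\Lambda$ on $X$: a continuous map $\varphi\colon\mathbb T\times X\times\Lambda\to X$ with $\phi^\lambda:=\varphi(\cdot,\cdot,\lambda)\in\mathbf{DS}(\mathbb T,X)$ for all $\lambda$; identified with its transpose $\varphi_*\colon\lambda\mapsto\phi^\lambda$.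 Sheaves: let $\mathcal S$ be the sheaf of bounded distributive lattices on $\Lambda$ with $\mathcal S(\Omega)$ the set of maps $\lambda\mapsto A_\lambda\in\mathsf{Att}(\phi^\lambda)$, $\lambda\in\Omega$, such that each $\mu\in\Omega$ has an open neighborhood $\Omega_0\subset\Omega$ and a set $U\subset X$ with $U\in\mathsf{ANbhd}(\phi^\lambda)$ and $A_\lambda=\omega_{\phi^\lambda}(U)$ for all $\lambda\in\Omega_0$; operations are pointwise. (This is the sheaf of sections of the pullback by $\varphi_*$ of the étale space of pairs $(\phi,A)$, $A\in\mathsf{Att}(\phi)$.) For a bounded distributive lattice $L$: $\mathsf R L$ is its Booleanization (minimal Boolean extension, i.e. the Boolean algebra of clopen subsets of the Priestley spectrum of $L$) regarded as a Boolean ring with symmetric difference as sum and intersection as product; $\mathbb Z_2L$ is the monoid algebra over $\mathbb Z_2$ of the monoid $(L,\wedge)$. $\mathcal A^{\varphi_*}$ is the sheafification of $\Omega\mapsto\mathsf R(\mathcal S(\Omega))$ and $\mathcal A\mathit{tt}^{\varphi_*}$ is the sheafification of $\Omega\mapsto\mathbb Z_2(\mathcal S(\Omega))$. A sheaf $\mathcal F$ is locally constant if $\Lambda$ has an open cover $\{\Lambda_i\}$ such that each $\mathcal F|_{\Lambda_i}$ is (isomorphic to) a constant sheaf. Conjugacy: $\varphi_*\colon\Lambda\to\mathbf{DS}(\mathbb T,X)$ and $\psi_*\colon\Lambda\to\mathbf{DS}(\mathbb T,Y)$ are conjugate if there are continuous $h\colon\Lambda\times X\to Y$ and $\tau\colon\Lambda\times\mathbb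 T\times X\to\mathbb T$ such that (i) for every $\lambda$, $h^\lambda=h(\lambda,\cdot)$ is a homeomorphism, $\tau(\lambda,0,x)=0$, $t\mapsto\tau(\lambda,t,x)$ is a strictly increasing bijection of $\mathbb T$ for each $x$, and $h^\lambda(\phi^\lambda(t,x))=\psi^\lambda(\tau(\lambda,t,x),h^\lambda(x))$; (ii) the connected components $X_i$ of $X$ and $Y_i$ of $Y$ can be indexed, independently of $\lambda$, so that $h^\lambda(X_i)=Y_i$ for all $\lambda$. Stability: $\varphi_*$ is stable at $\lambda_0$ if there is an open neighborhood $N$ of $\lambda_0$ such that $\varphi_*|_N$ is conjugate to the constant parametrization $N\ni\lambda\mapsto\phi^{\lambda_0}$. *)

(* Defs.v *)
From HB Require Import structures.
From mathcomp Require Import all_boot all_order all_algebra.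
From mathcomp Require Import all_classical all_reals topology.
(* The notations of monalg clash with those of classical_sets. *)
From mathcomp.multinomials Require monalg.
Import -(notations) monalg.

Set Implicit Arguments.
Unset Strict Implicit.
Unset Printing Implicit Defensive.

Import Order.TTheory GRing.Theory Num.Theory.
Import numFieldTopology.Exports.

Local Open Scope quotient_scope.
Local Open Scope classical_set_scope.
Local Open Scope ring_scope.

Section Opens.
Context (T : topologicalType).

Record opens := Opens { oset :> set T; oset_open : open oset }.

Definition opensT := Opens (@openT T).

Lemma opens_subT (U : opens) : U `<=` opensT.
Proof. exact: subsetT. Qed.

Definition opensI (U V : opens) := Opens (openI (oset_open U) (oset_open V)).

Lemma opensIl (U V : opens) : opensI U V `<=` U.
Proof. exact: subIsetl. Qed.

Lemma opensIr (U V : opens) : opensI U V `<=` V.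
Proof. exact: subIsetr. Qed.

Definition incl (U V : set T) (UV : U `<=` V) (x : U) : V :=
  exist _ (val x) (mem_set (UV _ (set_valP x))).

End Opens.

Record presheaf (T : topologicalType) := Presheaf {
  psec :> opens T -> comPzRingType;
  pres : forall U V : opens T, V `<=` U -> {rmorphism psec U -> psec V};
  pres_id : forall (U : opens T) (UU : U `<=` U) (s : psec U), pres UU s = s;
  pres_comp : forall (U V W : opens T) (VU : V `<=` U) (WV : W `<=` V)
    (WU : W `<=` U) (s : psec U), pres WV (pres VU s) = pres WU s }.
Arguments pres {T} p {U V}.

Definition presheaf_iso (T : topologicalType) (F G : presheaf T) :=
  exists f : forall U : opens T, {rmorphism F U -> G U},
    (forall U, bijective (f U)) /\
    (forall (U V : opens T) (VU : V `<=` U) (s : F U),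
      f V (pres F VU s) = pres G VU (f U s)).

Definition is_sheaf (T : topologicalType) (F : presheaf T) :=
  forall (U : opens T) (I : Type) (V : I -> opens T)
    (VU : forall i, V i `<=` U),
    U `<=` \bigcup_i V i ->
    forall s : forall i, F (V i),
      (forall i j, pres F (@opensIl _ (V i) (V j)) (s i) =
                   pres F (@opensIr _ (V i) (V j)) (s j)) ->
      exists! t : F U, forall i, pres F (VU i) t = s i.

Section Stalk.
Context (T : topologicalType) (F : presheaf T) (x : T).

Record germ_rep := GermRep {
  gr_open : opens T; gr_in : oset gr_open x; gr_sec : F gr_open }.

HB.instance Definition _ := gen_eqMixin germ_rep.
HB.instance Definition _ := gen_choiceMixin germ_rep.

Definition same_germ (a b : germ_rep) :=
  exists (W : opens T) (Wa : W `<=` gr_open a) (Wb : W `<=` gr_open b),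
    oset W x /\ pres F Wa (gr_sec a) = pres F Wb (gr_sec b).

Definition germ_eqv (a b : germ_rep) : bool := `[< same_germ a b >].

Fact germ_eqv_equiv : equiv_class_of germ_eqv.
Proof.
split=> [a|a b|b a c].
- by apply/asboolP; exists (gr_open a), (@subset_refl _ _), (@subset_refl _ _);
    split => //; exact: gr_in.
- by apply/asboolP/asboolP => -[W [Wa [Wb [Wx e]]]]; exists W, Wb, Wa.
move=> /asboolP[W [Wa [Wb [Wx e]]]] /asboolP[W' [Wb' [Wc [Wx' e']]]].
apply/asboolP; pose O := opensI W W'.
have OW : O `<=` W by apply: subIsetl.
have OW' : O `<=` W' by apply: subIsetr.
exists O, (subset_trans OW Wa), (subset_trans OW' Wc); split => //.
rewrite -(pres_comp Wa OW) e.
by rewrite -(pres_comp Wc OW') -e' !(pres_comp _ _ (subset_trans OW Wb)).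
Qed.

Canonical germ_eqv_rel := EquivRelPack germ_eqv_equiv.

Definition stalk := {eq_quot germ_eqv}.
HB.instance Definition _ := Choice.on stalk.
HB.instance Definition _ := EqQuotient.on stalk.

Definition germ (U : opens T) (Ux : oset U x) (s : F U) : stalk :=
  \pi_stalk (GermRep Ux s).

Lemma germP (U V : opens T) (Ux : oset U x) (Vx : oset V x)
    (s : F U) (t : F V) :
  germ Ux s = germ Vx t <-> same_germ (GermRep Ux s) (GermRep Vx t).
Proof. by split=> [/eqmodP/asboolP//|h]; apply/eqmodP/asboolP. Qed.

Lemma germ_res (U V : opens T) (VU : V `<=` U) (Vx : oset V x)
    (Ux : oset U x) (s : F U) :
  germ Vx (pres F VU s) = germ Ux s.
Proof.
apply/germP; exists V, (@subset_refl _ _), VU; split => //=.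
by rewrite pres_id.
Qed.

Lemma germW (a : stalk) :
  exists (U : opens T) (Ux : oset U x) (s : F U), a = germ Ux s.
Proof. by elim/quotW: a => -[U Ux s]; exists U, Ux, s. Qed.

Lemma germW2 (a b : stalk) :
  exists (U : opens T) (Ux : oset U x) (s t : F U),
    a = germ Ux s /\ b = germ Ux t.
Proof.
have [U [Ux [s ->]]] := germW a; have [V [Vx [t ->]]] := germW b.
exists (opensI U V), (conj Ux Vx), (pres F (@opensIl _ _ _) s),
  (pres F (@opensIr _ _ _) t).
by rewrite !(germ_res _ _ Ux) !(germ_res _ _ Vx).
Qed.

Lemma germW3 (a b c : stalk) :
  exists (U : opens T) (Ux : oset U x) (s t u : F U),
    [/\ a = germ Ux s, b = germ Ux t & c = germ Ux u].
Proof.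
have [U [Ux [s [t [-> ->]]]]] := germW2 a b; have [V [Vx [u ->]]] := germW c.
exists (opensI U V), (conj Ux Vx), (pres F (@opensIl _ _ _) s),
  (pres F (@opensIl _ _ _) t), (pres F (@opensIr _ _ _) u).
by rewrite !(germ_res _ _ Ux) !(germ_res _ _ Vx).
Qed.

Definition stalk_op2 (op : forall U : opens T, F U -> F U -> F U) (a b : stalk)
    : stalk :=
  let a := repr a in let b := repr b in
  @germ (opensI (gr_open a) (gr_open b)) (conj (gr_in a) (gr_in b))
    (op _ (pres F (@opensIl _ _ _) (gr_sec a))
          (pres F (@opensIr _ _ _) (gr_sec b))).

Lemma stalk_op2E (op : forall U : opens T, F U -> F U -> F U) :
  (forall (U V : opens T) (VU : V `<=` U) (s t : F U),
     pres F VU (op U s t) = op V (pres F VU s) (pres F VU t)) ->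
  forall (U : opens T) (Ux : oset U x) (s t : F U),
    stalk_op2 op (germ Ux s) (germ Ux t) = germ Ux (op U s t).
Proof.
move=> opres U Ux s t; rewrite /stalk_op2 /germ.
case: (piP stalk (GermRep Ux s)) => a; case: (piP stalk (GermRep Ux t)) => b.
move=> /eqmodP/asboolP[W' [W'U [W'b [W'x e']]]].
move=> /eqmodP/asboolP[W [WU [Wa [Wx e]]]].
apply/eqmodP/asboolP; rewrite /same_germ /=.
have OW : opensI W W' `<=` W by apply: subIsetl.
have OW' : opensI W W' `<=` W' by apply: subIsetr.
have h : opensI W W' `<=` opensI (gr_open a) (gr_open b) by apply: setISS.
exists (opensI W W'), h, (subset_trans OW WU); split=> //.
rewrite !opres !(pres_comp _ _ (subset_trans OW Wa)).
rewrite (pres_comp _ _ (subset_trans OW' W'b)).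
rewrite -(pres_comp Wa OW) -(pres_comp W'b OW') -e -e' /=.
by rewrite !(pres_comp _ _ (subset_trans OW WU)).
Qed.

Definition stalk_zero : stalk := @germ (opensT T) I 0.
Definition stalk_one : stalk := @germ (opensT T) I 1.
Definition stalk_opp : stalk -> stalk := fun a =>
  germ (gr_in (repr a)) (- gr_sec (repr a)).
Definition stalk_add := stalk_op2 (fun _ s t => s + t).
Definition stalk_mul := stalk_op2 (fun _ s t => s * t).

Lemma germ0 (U : opens T) (Ux : oset U x) : germ Ux 0 = stalk_zero.
Proof.
by rewrite /stalk_zero -(germ_res (@opens_subT _ U) Ux) rmorph0.
Qed.

Lemma germ1 (U : opens T) (Ux : oset U x) : germ Ux 1 = stalk_one.
Proof.
by rewrite /stalk_one -(germ_res (@opens_subT _ U) Ux) rmorph1.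
Qed.

Lemma germD (U : opens T) (Ux : oset U x) (s t : F U) :
  stalk_add (germ Ux s) (germ Ux t) = germ Ux (s + t).
Proof. by apply: stalk_op2E => *; rewrite rmorphD. Qed.

Lemma germM (U : opens T) (Ux : oset U x) (s t : F U) :
  stalk_mul (germ Ux s) (germ Ux t) = germ Ux (s * t).
Proof. by apply: stalk_op2E => *; rewrite rmorphM. Qed.

Lemma germN (U : opens T) (Ux : oset U x) (s : F U) :
  stalk_opp (germ Ux s) = germ Ux (- s).
Proof.
rewrite /stalk_opp /germ.
case: (piP stalk (GermRep Ux s)) => a /eqmodP/asboolP[W [WU [Wa [Wx e]]]].
apply/eqmodP/asboolP; exists W, Wa, WU; split => //=.
by rewrite !rmorphN -e.
Qed.

Fact stalk_addA : associative stalk_add.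
Proof.
by move=> a b c; have [U [Ux [s [t [u [-> -> ->]]]]]] := germW3 a b c;
  rewrite !germD addrA.
Qed.
Fact stalk_addC : commutative stalk_add.
Proof.
by move=> a b; have [U [Ux [s [t [-> ->]]]]] := germW2 a b;
  rewrite !germD addrC.
Qed.
Fact stalk_add0 : left_id stalk_zero stalk_add.
Proof.
by move=> a; have [U [Ux [s ->]]] := germW a; rewrite -(germ0 Ux) germD add0r.
Qed.
Fact stalk_addN : left_inverse stalk_zero stalk_opp stalk_add.
Proof.
by move=> a; have [U [Ux [s ->]]] := germW a;
  rewrite germN germD addNr germ0.
Qed.
HB.instance Definition _ := GRing.isZmodule.Build stalk
  stalk_addA stalk_addC stalk_add0 stalk_addN.

Fact stalk_mulA : associative stalk_mul.
Proof.
by move=> a b c; have [U [Ux [s [t [u [-> -> ->]]]]]] := germW3 a b c;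
  rewrite !germM mulrA.
Qed.
Fact stalk_mulC : commutative stalk_mul.
Proof.
by move=> a b; have [U [Ux [s [t [-> ->]]]]] := germW2 a b;
  rewrite !germM mulrC.
Qed.
Fact stalk_mul1 : left_id stalk_one stalk_mul.
Proof.
by move=> a; have [U [Ux [s ->]]] := germW a; rewrite -(germ1 Ux) germM mul1r.
Qed.
Fact stalk_mulDl : left_distributive stalk_mul +%R.
Proof.
move=> a b c; have [U [Ux [s [t [u [-> -> ->]]]]]] := germW3 a b c.
have D (r q : F U) : germ Ux r + germ Ux q = germ Ux (r + q) := germD _ _ _.
by rewrite !(D, germM) mulrDl.
Qed.
HB.instance Definition _ := GRing.Zmodule_isComPzRing.Build stalk
  stalk_mulA stalk_mulC stalk_mul1 stalk_mulDl.

Lemma germ_is_zmod_morphism (U : opens T) (Ux : oset U x) :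
  zmod_morphism (germ Ux).
Proof. by move=> s t; rewrite -germD -germN. Qed.

Lemma germ_is_monoid_morphism (U : opens T) (Ux : oset U x) :
  monoid_morphism (germ Ux).
Proof. by split=> [|s t]; [exact: germ1|rewrite -germM]. Qed.

HB.instance Definition _ (U : opens T) (Ux : oset U x) :=
  GRing.isZmodMorphism.Build (F U) stalk (germ Ux) (germ_is_zmod_morphism Ux).
HB.instance Definition _ (U : opens T) (Ux : oset U x) :=
  GRing.isMonoidMorphism.Build (F U) stalk (germ Ux)
    (germ_is_monoid_morphism Ux).

End Stalk.

Section Sheafification.
Context (T : topologicalType) (F : presheaf T).

Definition locally_induced (U : opens T)
    (f : forall x : U, stalk F (val x)) :=
  forall x : U, exists (V : opens T) (s : F V), oset V (val x) /\
    forall (y : U) (Vy : oset V (val y)), f y = germ Vy s.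

(* Sections of the sheafification: functions to the stalks that are locally
   given by sections of the presheaf. *)
Record shsec (U : opens T) := ShSec {
  shsec_fun :> forall x : U, stalk F (val x);
  shsec_loc : locally_induced shsec_fun }.

HB.instance Definition _ (U : opens T) := gen_eqMixin (shsec U).
HB.instance Definition _ (U : opens T) := gen_choiceMixin (shsec U).

Lemma shsecP (U : opens T) (f g : shsec U) : (forall x, f x = g x) -> f = g.
Proof.
case: f g => [f hf] [g hg] /= fg.
have e : f = g by apply: functional_extensionality_dep.
by case: _ / e hg => hg; congr ShSec; exact: Prop_irrelevance.
Qed.

Section Ops.
Context (U : opens T).
Implicit Types f g h : shsec U.

Fact shsec0_loc : locally_induced (fun x : U => 0 : stalk F (val x)).
Proof.
move=> x; exists U, 0.
by split=> [|y Vy]; [exact: set_valP|rewrite raddf0].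
Qed.

Fact shsec1_loc : locally_induced (fun x : U => 1 : stalk F (val x)).
Proof.
move=> x; exists U, 1.
by split=> [|y Vy]; [exact: set_valP|rewrite rmorph1].
Qed.

Fact shsecN_loc f : locally_induced (fun x => - f x).
Proof.
move=> x; have [V [s [Vx e]]] := shsec_loc f x; exists V, (- s).
by split=> // y Vy; rewrite rmorphN (e y Vy).
Qed.

Lemma shsec_loc2 f g (x : U) : exists (V : opens T) (s t : F V),
  oset V (val x) /\ forall (y : U) (Vy : oset V (val y)),
    f y = germ Vy s /\ g y = germ Vy t.
Proof.
have [V [s [Vx e]]] := shsec_loc f x; have [W [t [Wx e']]] := shsec_loc g x.
exists (opensI V W), (pres F (@opensIl _ _ _) s), (pres F (@opensIr _ _ _) t).
split=> // y [Vy Wy].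
by rewrite (germ_res _ _ Vy) (germ_res _ _ Wy) -e -e'.
Qed.

Fact shsecD_loc f g : locally_induced (fun x => f x + g x).
Proof.
move=> x; have [V [s [t [Vx e]]]] := shsec_loc2 f g x; exists V, (s + t).
by split=> // y Vy; have [-> ->] := e y Vy; rewrite rmorphD.
Qed.

Fact shsecM_loc f g : locally_induced (fun x => f x * g x).
Proof.
move=> x; have [V [s [t [Vx e]]]] := shsec_loc2 f g x; exists V, (s * t).
by split=> // y Vy; have [-> ->] := e y Vy; rewrite rmorphM.
Qed.

Definition shsec0 := ShSec shsec0_loc.
Definition shsec1 := ShSec shsec1_loc.
Definition shsecN f := ShSec (shsecN_loc f).
Definition shsecD f g := ShSec (shsecD_loc f g).
Definition shsecM f g := ShSec (shsecM_loc f g).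

Fact shsecDA : associative shsecD.
Proof. by move=> f g h; apply: shsecP => x /=; rewrite addrA. Qed.
Fact shsecDC : commutative shsecD.
Proof. by move=> f g; apply: shsecP => x /=; rewrite addrC. Qed.
Fact shsecD0 : left_id shsec0 shsecD.
Proof. by move=> f; apply: shsecP => x /=; rewrite add0r. Qed.
Fact shsecDN : left_inverse shsec0 shsecN shsecD.
Proof. by move=> f; apply: shsecP => x /=; rewrite addNr. Qed.
HB.instance Definition _ := GRing.isZmodule.Build (shsec U)
  shsecDA shsecDC shsecD0 shsecDN.

Fact shsecMA : associative shsecM.
Proof. by move=> f g h; apply: shsecP => x /=; rewrite mulrA. Qed.
Fact shsecMC : commutative shsecM.
Proof. by move=> f g; apply: shsecP => x /=; rewrite mulrC. Qed.
Fact shsecM1 : left_id shsec1 shsecM.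
Proof. by move=> f; apply: shsecP => x /=; rewrite mul1r. Qed.
Fact shsecMDl : left_distributive shsecM +%R.
Proof. by move=> f g h; apply: shsecP => x /=; rewrite mulrDl. Qed.
HB.instance Definition _ := GRing.Zmodule_isComPzRing.Build (shsec U)
  shsecMA shsecMC shsecM1 shsecMDl.

End Ops.

Section Restriction.
Context (U V : opens T) (VU : V `<=` U).

Fact shres_loc (f : shsec U) :
  locally_induced (fun x : V => f (incl VU x) : stalk F (val x)).
Proof.
move=> x; have [W [s [Wx e]]] := shsec_loc f (incl VU x).
by exists W, s; split=> // y Wy; rewrite (e (incl VU y) Wy).
Qed.

Definition shres (f : shsec U) : shsec V := ShSec (shres_loc f).

Fact shres_is_zmod_morphism : zmod_morphism shres.
Proof. by move=> f g; apply: shsecP. Qed.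
Fact shres_is_monoid_morphism : monoid_morphism shres.
Proof. by split=> [|f g]; apply: shsecP. Qed.
HB.instance Definition _ :=
  GRing.isZmodMorphism.Build (shsec U) (shsec V) shres shres_is_zmod_morphism.
HB.instance Definition _ :=
  GRing.isMonoidMorphism.Build (shsec U) (shsec V) shres
    shres_is_monoid_morphism.

End Restriction.

Lemma shsec_irr (U : opens T) (f : shsec U) (x : T) (p q : x \in oset U) :
  f (exist _ x p) = f (exist _ x q).
Proof. by have -> : p = q by exact: Prop_irrelevance. Qed.

Lemma shsec_val (U : opens T) (f : shsec U) (x : U) (p : val x \in oset U) :
  f (exist _ (val x) p) = f x.
Proof. by case: x p => x xU p; exact: shsec_irr. Qed.

Fact shres_id (U : opens T) (UU : U `<=` U) (f : shsec U) : shres UU f = f.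
Proof. by apply: shsecP => -[x xU] /=; exact: shsec_irr. Qed.

Fact shres_comp (U V W : opens T) (VU : V `<=` U) (WV : W `<=` V)
  (WU : W `<=` U) (f : shsec U) : shres WV (shres VU f) = shres WU f.
Proof. by apply: shsecP => -[x xW] /=; exact: shsec_irr. Qed.

Definition sheafify : presheaf T :=
  @Presheaf T (fun U => shsec U) (fun U V VU => shres VU) shres_id shres_comp.

Lemma sheafify_is_sheaf : is_sheaf sheafify.
Proof.
move=> U I V VU cov s compat.
have cov' (x : U) : exists i, oset (V i) (val x).
  by have [i _ Vx] := cov _ (set_valP x); exists i.
pose ix x := projT1 (cid (cov' x)).
have ixP x : oset (V (ix x)) (val x) by rewrite /ix; case: cid.
pose f (x : U) : stalk F (val x) :=
  s (ix x) (exist _ (val x) (mem_set (ixP x))).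
have fE i (x : U) (Vx : val x \in oset (V i)) : f x = s i (exist _ (val x) Vx).
  have Ix : val x \in oset (opensI (V (ix x)) (V i)).
    by apply/mem_set; split; [exact: ixP|exact: set_mem].
  have /(congr1 (fun g : shsec _ => g (exist _ (val x) Ix))) := compat (ix x) i.
  rewrite /= => h; rewrite /f.
  transitivity (s (ix x)
      (incl (@opensIl _ (V (ix x)) (V i)) (exist _ (val x) Ix))).
    exact: shsec_irr.
  by rewrite h; exact: shsec_irr.
have floc : locally_induced f.
  move=> x; have Vx := mem_set (ixP x).
  have [W [t [Wx e]]] := shsec_loc (s (ix x)) (exist _ (val x) Vx).
  exists (opensI (V (ix x)) W), (pres F (@opensIr _ _ _) t); split.
    by split; [exact: ixP|].
  move=> y [Vy Wy]; rewrite (germ_res _ _ Wy) (fE _ _ (mem_set Vy)).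
  exact: (e (exist _ (val y) (mem_set Vy)) Wy).
exists (ShSec floc); split=> [i|g gs]; apply: shsecP => x /=.
  rewrite (fE i (incl (VU i) x) (mem_set (set_valP x))) /=.
  exact: shsec_val.
rewrite (fE (ix x) x (mem_set (ixP x))) -gs /=.
exact: shsec_val.
Qed.

End Sheafification.

Record sheaf (T : topologicalType) := Sheaf {
  sheaf_presheaf :> presheaf T;
  sheafP : is_sheaf sheaf_presheaf }.

Definition sheafification (T : topologicalType) (F : presheaf T) : sheaf T :=
  Sheaf (@sheafify_is_sheaf T F).

Definition const_presheaf (T : topologicalType) (A : comPzRingType) :
    presheaf T :=
  @Presheaf T (fun _ => A) (fun _ _ _ => idfun)
    (fun _ _ _ => erefl) (fun _ _ _ _ _ _ _ => erefl).

Definition const_sheaf (T : topologicalType) (A : comPzRingType) : sheaf T :=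
  sheafification (const_presheaf T A).

Section Restriction.
Context (T : topologicalType) (F : presheaf T) (U : opens T).

Lemma open_image_val (V : opens U) : open (val @` V).
Proof.
have [W oW WV] := oset_open V.
suff -> : val @` V = W `&` U by exact: openI (oset_open U).
rewrite -WV; apply/seteqP; split=> [_ [x Wx <-]|x [Wx Ux]].
  by split=> //; exact: set_valP.
by exists (exist _ x (mem_set Ux)).
Qed.

Definition opens_image (V : opens U) : opens T := Opens (open_image_val V).

Lemma opens_imageS (V W : opens U) :
  W `<=` V -> opens_image W `<=` opens_image V.
Proof. exact: image_subset. Qed.

(* [F] restricted to [U], as a presheaf on the subspace [U]: an open set of the
   subspace is read as an open set of [T]. *)
Definition restrict : presheaf U :=
  @Presheaf U (fun V => F (opens_image V))
    (fun V W WV => pres F (opens_imageS WV))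
    (fun V VV s => pres_id (opens_imageS VV) s)
    (fun V W X WV XW XV s =>
       pres_comp (opens_imageS WV) (opens_imageS XW) (opens_imageS XV) s).

End Restriction.

Definition locally_constant (T : topologicalType) (F : sheaf T) :=
  exists (I : Type) (D : I -> opens T),
    \bigcup_i D i = [set: T] /\
    forall i, exists A : comPzRingType,
      presheaf_iso (restrict F (D i)) (const_sheaf (D i) A).

(* MathComp's [TBLatticeMorphism] only asks for preservation of [\bot] and
   [\top], not of meets and joins. *)
HB.structure Definition BoundedLatticeMorphism d (L : tbLatticeType d)
    d' (M : tbLatticeType d') :=
  {f of @Order.LatticeMorphism d L d' M f
     & @Order.TBLatticeMorphism d L d' M f}.
Notation "{ 'bdlmorphism' L -> M }" :=
  (@BoundedLatticeMorphism.type _ L%type _ M%type)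
  (at level 0, L at level 98, M at level 99) : type_scope.

Section Priestley.
Context d (L : tbDistrLatticeType d).
Local Open Scope order_scope.

(* Priestley spectrum: the prime ideals of [L], with the topology generated by
   the sets {I | a \notin I} and their complements. *)
Definition prime_ideal (I : set L) := [/\ I \bot, ~ I \top,
  forall a b, (a <= b)%O -> I b -> I a,
  forall a b, I a -> I b -> I (Order.join a b) &
  forall a b, I (Order.meet a b) -> I a \/ I b].

Definition spectrum : Type := set_type prime_ideal.
HB.instance Definition _ := Choice.on spectrum.

Definition basic_clopen (a : L) : set spectrum := [set I | ~ (val I : set L) a].

Definition priestley_subbase : set (set spectrum) :=
  [set A | exists a, A = basic_clopen a \/ A = ~` basic_clopen a].

HB.instance Definition _ :=
  isSubBaseTopological.Build spectrum priestley_subbase id.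

End Priestley.

(* A Boolean ring: the sum is the symmetric difference, the product is the
   intersection. *)
Definition booleanization d (L : tbDistrLatticeType d) : Type :=
  set_type [set A : set (spectrum L) | clopen A].
HB.instance Definition _ d (L : tbDistrLatticeType d) :=
  Choice.on (booleanization L).

Lemma priestley_subbase_open d (L : tbDistrLatticeType d)
    (A : set (spectrum L)) :
  priestley_subbase A -> open A.
Proof.
move=> h; exists [set A]; last by rewrite bigcup_set1.
by move=> _ ->; exact: finI_from1.
Qed.

Section BooleanRing.
Context d (L : tbDistrLatticeType d).
Let B := booleanization L.
Implicit Types a b c : B.

Lemma booleanP a b : (val a : set (spectrum L)) = val b -> a = b.
Proof. exact: val_inj. Qed.

Lemma clopenY (T : topologicalType) (U V : set T) :
  clopen U -> clopen V -> clopen (U `+` V).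
Proof.
by move=> cU cV; rewrite /setY !setDE; apply: clopenU; apply: clopenI => //;
  apply: clopenC.
Qed.

Definition bool_of (A : set (spectrum L)) (cA : clopen A) : B :=
  exist _ A (mem_set cA).
Definition bool0 : B := bool_of clopen0.
Definition bool1 : B := bool_of clopenT.
Definition boolD a b : B := bool_of (clopenY (set_valP a) (set_valP b)).
Definition boolM a b : B := bool_of (clopenI (set_valP a) (set_valP b)).

Fact boolDA : associative boolD.
Proof. by move=> a b c; apply: booleanP; exact: setYA. Qed.
Fact boolDC : commutative boolD.
Proof. by move=> a b; apply: booleanP; exact: setYC. Qed.
Fact boolD0 : left_id bool0 boolD.
Proof. by move=> a; apply: booleanP; exact: set0Y. Qed.
Fact boolDN : left_inverse bool0 id boolD.
Proof. by move=> a; apply: booleanP; exact: setYK. Qed.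
HB.instance Definition _ := GRing.isZmodule.Build (booleanization L)
  boolDA boolDC boolD0 boolDN.

Fact boolMA : associative boolM.
Proof. by move=> a b c; apply: booleanP; exact: setIA. Qed.
Fact boolMC : commutative boolM.
Proof. by move=> a b; apply: booleanP; exact: setIC. Qed.
Fact boolM1 : left_id bool1 boolM.
Proof. by move=> a; apply: booleanP; exact: setTI. Qed.
Fact boolMDl : left_distributive boolM +%R.
Proof. by move=> a b c; apply: booleanP; exact: setIYl. Qed.
HB.instance Definition _ := GRing.Zmodule_isComPzRing.Build (booleanization L)
  boolMA boolMC boolM1 boolMDl.

End BooleanRing.

Section BooleanizationMap.
Context d (L : tbDistrLatticeType d) d' (M : tbDistrLatticeType d').
Context (f : {bdlmorphism L -> M}).

Fact preimage_prime_ideal (J : spectrum M) :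
  prime_ideal (f @^-1` (val J : set M)).
Proof.
have [J0 J1 Jle JU JI] := set_valP J; split; rewrite /= ?omorph0 ?omorph1 //.
- by move=> a b ab; apply: Jle; exact: omorph_le.
- by move=> a b; rewrite omorphU; exact: JU.
- by move=> a b; rewrite omorphI; exact: JI.
Qed.

Definition spectrum_map (J : spectrum M) : spectrum L :=
  exist _ (f @^-1` (val J : set M)) (mem_set (preimage_prime_ideal J)).

Lemma spectrum_map_continuous : continuous spectrum_map.
Proof.
apply/continuousP => _ [D DD <-]; rewrite preimage_bigcup.
apply: bigcup_open => _ /DD[E ED <-]; rewrite preimage_bigcap bigcap_fset.
rewrite big_seq; elim/big_ind: _ => [|A B oA oB|A /ED]; first exact: openT.
  exact: openI.
rewrite inE => -[a [|] ->]; apply: priestley_subbase_open; exists (f a);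
  by [left|right].
Qed.

Definition booleanization_map (A : booleanization L) : booleanization M :=
  bool_of (preimage_clopen (set_valP A) spectrum_map_continuous).

Fact booleanization_map_is_zmod_morphism : zmod_morphism booleanization_map.
Proof. by move=> A B; apply: booleanP. Qed.
Fact booleanization_map_is_monoid_morphism :
  monoid_morphism booleanization_map.
Proof. by split=> [|A B]; apply: booleanP. Qed.
HB.instance Definition _ :=
  GRing.isZmodMorphism.Build (booleanization L) (booleanization M)
    booleanization_map booleanization_map_is_zmod_morphism.
HB.instance Definition _ :=
  GRing.isMonoidMorphism.Build (booleanization L) (booleanization M)
    booleanization_map booleanization_map_is_monoid_morphism.

End BooleanizationMap.

Lemma booleanization_map_id d (L : tbDistrLatticeType d)
  (f : {bdlmorphism L -> L}) : f =1 id ->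
  forall A, booleanization_map f A = A.
Proof.
move=> f1 A; apply: booleanP => /=; apply/funext => J; rewrite /preimage /=.
by congr (sval A _); apply: val_inj => /=; apply/funext => a;
  rewrite /preimage /= f1.
Qed.

Lemma booleanization_map_comp d (L : tbDistrLatticeType d)
  d' (M : tbDistrLatticeType d') d'' (N : tbDistrLatticeType d'')
  (f : {bdlmorphism L -> M}) (g : {bdlmorphism M -> N})
  (h : {bdlmorphism L -> N}) : h =1 g \o f ->
  forall A, booleanization_map g (booleanization_map f A) =
            booleanization_map h A.
Proof.
move=> hE A; apply: booleanP => /=; apply/funext => J; rewrite /preimage /=.
by congr (sval A _); apply: val_inj => /=; apply/funext => a;
  rewrite /preimage /= hE.
Qed.

(* [L] as the monoid (L, meet, \top); monalg asks in addition that only the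
   unit be invertible. *)
Definition meet_monoid d (L : tbDistrLatticeType d) : Type := L.

HB.instance Definition _ d (L : tbDistrLatticeType d) :=
  Choice.on (meet_monoid L).

Section MeetMonoid.
Context d (L : tbDistrLatticeType d).
Import Order.LTheory.
Local Open Scope order_scope.

Fact meet_eq_top (a b : L) : Order.meet a b = \top -> a = \top /\ b = \top.
Proof. by move/eqP; rewrite meet_eq1 => /andP[/eqP-> /eqP->]. Qed.

HB.instance Definition _ := Choice_isMonomialDef.Build (meet_monoid L)
  (@meetA _ L) (@meet1x _ L) (@meetx1 _ L) meet_eq_top.
HB.instance Definition _ := MonomialDef_isConomialDef.Build (meet_monoid L)
  (@meetC _ L).

End MeetMonoid.

Definition monoid_algebra d (L : tbDistrLatticeType d) : comPzRingType :=
  malg (meet_monoid L) 'F_2.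

Section MonoidAlgebraMap.
Context d (L : tbDistrLatticeType d) d' (M : tbDistrLatticeType d').
Context (f : {bdlmorphism L -> M}).

Definition monomial_map (a : meet_monoid L) : malg (meet_monoid M) 'F_2 :=
  mkmalgU (f a : meet_monoid M) 1.

Fact monomial_map_morphism : mmorphism monomial_map.
Proof.
split=> [a b|]; rewrite /monomial_map.
  rewrite [RHS]malgM_def fgmulUU mulr1; congr mkmalgU.
  exact: (omorphI f (a : L) (b : L)).
by rewrite [X in mkmalgU X](omorph1 f).
Qed.
HB.instance Definition _ :=
  isMultiplicative.Build _ _ monomial_map monomial_map_morphism.

Definition monoid_algebra_map :
    {rmorphism monoid_algebra L -> monoid_algebra M} :=
  mmap (@mkmalgU (meet_monoid M) 'F_2 one) monomial_map.

Lemma monoid_algebra_mapU (a : L) c :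
  monoid_algebra_map (mkmalgU (a : meet_monoid L) c) =
  mkmalgU (f a : meet_monoid M) c.
Proof.
by rewrite /monoid_algebra_map /= mmapU malgM_def fgmulUU mulr1 mul1m.
Qed.

End MonoidAlgebraMap.

Lemma monoid_algebra_map_id d (L : tbDistrLatticeType d)
  (f : {bdlmorphism L -> L}) : f =1 id ->
  forall g, monoid_algebra_map f g = g.
Proof.
move=> f1 g; rewrite (monalgE g) raddf_sum; apply: eq_bigr => a _.
by rewrite [LHS]monoid_algebra_mapU f1.
Qed.

Lemma monoid_algebra_map_comp d (L : tbDistrLatticeType d)
  d' (M : tbDistrLatticeType d') d'' (N : tbDistrLatticeType d'')
  (f : {bdlmorphism L -> M}) (g : {bdlmorphism M -> N})
  (h : {bdlmorphism L -> N}) : h =1 g \o f ->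
  forall u, monoid_algebra_map g (monoid_algebra_map f u) =
            monoid_algebra_map h u.
Proof.
move=> hE u; rewrite (monalgE u) [monoid_algebra_map f _]raddf_sum.
rewrite [LHS]raddf_sum [RHS]raddf_sum; apply: eq_bigr => a _.
rewrite [RHS]monoid_algebra_mapU hE.
exact: etrans (congr1 (monoid_algebra_map g) (monoid_algebra_mapU f a _))
  (monoid_algebra_mapU g _ _).
Qed.

Variant time_kind := IntegerTime | NaturalTime | RealTime | NonnegRealTime.

Definition time_set (R : realType) (k : time_kind) : set R :=
  match k with
  | IntegerTime => [set t | t \is a Num.int]
  | NaturalTime => [set t | t \is a Num.nat]
  | RealTime => [set: R]
  | NonnegRealTime => [set t | 0 <= t]
  end.
Arguments time_set : clear implicits.

(* As a [set_type], the time space carries the subspace topology of [R]; this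
   is the discrete topology for integer times. *)
Notation time R k := (set_type (time_set R k)).

Section Time.
Context (R : realType) (k : time_kind).

Fact time_set0 : time_set R k 0.
Proof. by case: k => /=. Qed.

Fact time_setD (t s : R) :
  time_set R k t -> time_set R k s -> time_set R k (t + s).
Proof. by case: k => //=; [exact: rpredD|exact: rpredD|exact: addr_ge0]. Qed.

Definition time0 : time R k := exist _ 0 (mem_set time_set0).

Definition timeD (t s : time R k) : time R k :=
  exist _ (val t + val s) (mem_set (time_setD (set_valP t) (set_valP s))).

Lemma timeB (t s : time R k) : val t <= val s ->
  exists u : time R k, 0 <= val u /\ s = timeD t u.
Proof.
move=> ts; suff h : time_set R k (val s - val t).
  exists (exist _ (val s - val t) (mem_set h)); split.
    by rewrite /= subr_ge0.
  by apply: val_inj => /=; rewrite addrC subrK.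
have := set_valP t; have := set_valP s.
case: k t s ts => /= t s ts.
- by move=> *; apply: rpredB.
- by rewrite !natrEint => /andP[si _] /andP[ti _]; rewrite rpredB //= subr_ge0.
- by [].
- by rewrite subr_ge0.
Qed.

End Time.

Section DynamicalSystems.
Context (R : realType) (k : time_kind) (X : topologicalType).
Let T := time R k.

Definition is_dynsys (phi : T * X -> X) := [/\ continuous phi,
  forall x, phi (time0 R k, x) = x &
  forall t s x, phi (t, phi (s, x)) = phi (timeD t s, x)].

Record dynsys := DynSys { dyn_map :> T * X -> X; dynP : is_dynsys dyn_map }.

Implicit Types (phi : dynsys) (U : set X).

Definition tail phi U (t : T) : set X :=
  \bigcup_(s in [set s : T | val t <= val s]) ((fun x => phi (s, x)) @` U).

Definition omega phi U : set X :=
  \bigcap_(t in [set t : T | 0 <= val t]) closure (tail phi U t).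

Definition anbhd phi : set (set X) := [set U | omega phi U `<=` interior U].

Definition attractor phi : set (set X) := [set omega phi U | U in anbhd phi].

Lemma tail_le phi U t s : val t <= val s -> tail phi U s `<=` tail phi U t.
Proof. by move=> ts x [r /= sr xr]; exists r => //=; exact: le_trans sr. Qed.

Lemma omega_mono phi U V : U `<=` V -> omega phi U `<=` omega phi V.
Proof.
move=> UV x xU t t0; apply: closure_subset (xU t t0).
by apply: subset_bigcup => s _; exact: image_subset.
Qed.

Lemma omega0 phi : omega phi set0 = set0.
Proof.
rewrite -subset0 => x /(_ (time0 R k) (lexx _)).
rewrite /tail; under eq_bigcupr do rewrite image_set0.
by rewrite bigcup0 // closure0.
Qed.

Lemma omegaU phi U V : omega phi (U `|` V) = omega phi U `|` omega phi V.
Proof.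
apply/seteqP; split=> [x xUV|x [|]]; last 2 first.
- by apply: omega_mono; exact: subsetUl.
- by apply: omega_mono; exact: subsetUr.
apply: contrapT => /not_orP[].
move=> /existsNP[t /not_implyP[/= t0 xt]] /existsNP[s /not_implyP[/= s0 xs]].
wlog ts : U V xUV t s t0 s0 xt xs / val t <= val s.
  move=> h; have [|/ltW] := leP (val t) (val s); first exact: (h U V).
  by apply: (h V U) => //; rewrite setUC.
have /xUV : 0 <= val s by [].
have -> : tail phi (U `|` V) s = tail phi U s `|` tail phi V s.
  by rewrite /tail -bigcupU; apply: eq_bigcupr => r _; rewrite image_setU.
rewrite closureU => -[|//] /(closure_subset (tail_le ts)) //.
Qed.

Lemma anbhd0 phi : anbhd phi set0.
Proof. by rewrite /anbhd /= omega0. Qed.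

Lemma anbhdT phi : anbhd phi setT.
Proof. by rewrite /anbhd /= interiorT. Qed.

Lemma anbhdU phi U V : anbhd phi U -> anbhd phi V -> anbhd phi (U `|` V).
Proof.
move=> aU aV; rewrite /anbhd /= omegaU => x [/aU|/aV]; apply: interiorS.
  exact: subsetUl.
exact: subsetUr.
Qed.

Lemma anbhdI phi U V : anbhd phi U -> anbhd phi V -> anbhd phi (U `&` V).
Proof.
move=> aU aV x xUV; rewrite interiorI; split.
  by apply/aU/(omega_mono _ xUV); exact: subIsetl.
by apply/aV/(omega_mono _ xUV); exact: subIsetr.
Qed.

End DynamicalSystems.

HB.mixin Record isCompactSpace T & Topological T := {
  compact_space : compact [set: T] }.

#[short(type="compactMetricType")]
HB.structure Definition CompactMetric (R : numDomainType) :=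
  { T of Metric R T & isCompactSpace T }.

Section CompactDynamics.
Context (R : realType) (k : time_kind) (X : compactMetricType R).
Implicit Types (phi : dynsys R k X) (U V : set X).

Lemma dyn_continuous phi (t : time R k) : continuous (fun x => phi (t, x)).
Proof.
have [c _ _] := dynP phi; move=> x.
apply: (@continuous_comp _ _ _ (fun x => (t, x)) phi); last exact: c.
by apply: (@cvg_pair _ _ _ (nbhs x) (nbhs t) (nbhs x) _ _ _ (fun=> t) id);
  [exact: cvg_cst|exact: cvg_id].
Qed.

Lemma omega_subimage phi U (t : time R k) : 0 <= val t ->
  omega phi U `<=` (fun x => phi (t, x)) @` omega phi U.
Proof.
move=> t0 y yU; have hX : hausdorff_space X := @metric_hausdorff _ X.
pose K (r : time R k) := closure (tail phi U r).
have Kpre (r : time R k) : 0 <= val r -> exists2 z, K r z & phi (t, z) = y.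
  move=> r0; have rt0 : 0 <= val (timeD t r) by rewrite addr_ge0.
  have cK : closed ((fun x => phi (t, x)) @` K r).
    apply: compact_closed => //; apply: continuous_compact.
      by apply: continuous_subspaceT; exact: dyn_continuous.
    by apply: (subclosed_compact _ compact_space) => //; exact: closed_closure.
  have : closure ((fun x => phi (t, x)) @` K r) y.
    apply: closure_subset (yU _ rt0) => _ [s /= rs [u Uu <-]].
    have [w [w0 sE]] := @timeB _ _ (timeD t r) s rs.
    exists (phi (timeD r w, u)).
      apply: subset_closure; exists (timeD r w) => /=; last by exists u.
      by rewrite lerDl.
    have [_ _ D] := dynP phi; rewrite D sE; congr (phi (_, _)).
    by apply: val_inj => /=; rewrite addrA.
  by rewrite -((closure_id _).1 cK) => -[z Kz <-]; exists z.
pose C (r : time R k) := K r `&` [set z | phi (t, z) = y].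
pose F : set_system X :=
  [set A | exists2 r : time R k, 0 <= val r & C r `<=` A].
have FF : ProperFilter F.
  split.
    by move=> [r /Kpre[z Kz zy]] /(_ z); exact.
  split.
  - by exists (time0 R k) => //=.
  - move=> A B [r r0 rA] [s s0 sB].
    exists (timeD r s); first by rewrite /= addr_ge0.
    move=> z [Kz zy]; split; [apply: rA|apply: sB]; split=> //;
      apply: closure_subset Kz; apply: tail_le => /=.
      by rewrite lerDl.
    by rewrite lerDr.
  - by move=> A B AB [r r0 rA]; exists r => //; exact: subset_trans AB.
have [z [_ zF]] := @compact_space R X F FF filterT.
have zC (r : time R k) : 0 <= val r -> C r z.
  move=> r0; have cC : closed (C r).
    apply: closedI; first exact: closed_closure.
    rewrite (_ : mkset _ = (fun z => phi (t, z)) @^-1` [set y]) //.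
    apply: (iffLR (continuous_closedP _) (@dyn_continuous phi t)).
    exact/accessible_closed_set1/hausdorff_accessible.
  rewrite ((closure_id _).1 cC) => B zB; apply: zF => //.
  by exists r.
exists z; last by have [] := zC (time0 R k) (lexx _).
by move=> r r0; have [] := zC r r0.
Qed.

Lemma omega_idemS phi U : omega phi U `<=` omega phi (omega phi U).
Proof.
move=> x xU t t0; apply: subset_closure; exists t => //=.
exact: omega_subimage.
Qed.

Lemma omega_idem phi U : anbhd phi U -> omega phi (omega phi U) = omega phi U.
Proof.
move=> aU; apply/seteqP; split; last exact: omega_idemS.
by apply: omega_mono; apply: subset_trans aU _; exact: interior_subset.
Qed.

Lemma omega_capE phi U V : anbhd phi U -> anbhd phi V ->
  omega phi (omega phi U `&` omega phi V) = omega phi (U `&` V).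
Proof.
move=> aU aV; apply/seteqP; split.
  apply: omega_mono; apply: setISS.
    by apply: subset_trans aU _; exact: interior_subset.
  by apply: subset_trans aV _; exact: interior_subset.
apply: subset_trans (@omega_idemS _ _) _; apply: omega_mono => x xUV; split.
  by apply: omega_mono xUV; exact: subIsetl.
by apply: omega_mono xUV; exact: subIsetr.
Qed.

End CompactDynamics.

(* The continuous map [(t, x, l) |-> phi (t, x, l)] stands for its transpose
   [l |-> phi (., ., l)] into the space of dynamical systems. *)
Record pds (R : realType) (k : time_kind) (X Lam : topologicalType) := Pds {
  pds_map :> time R k * X * Lam -> X;
  pds_continuous : continuous pds_map;
  pds_dynsys : forall l, is_dynsys (fun tx => pds_map (tx, l)) }.

Definition pds_at (R : realType) (k : time_kind) (X Lam : topologicalType)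
  (phi : pds R k X Lam) (l : Lam) : dynsys R k X := DynSys (pds_dynsys phi l).

Section Stability.
Context (R : realType) (k : time_kind).
Implicit Types (X Y Lam : topologicalType).
Let T := time R k.

Fact pds_restrict_continuous X Lam (phi : pds R k X Lam) (N : set Lam) :
  continuous (fun p : T * X * N => phi (p.1, val p.2)).
Proof.
move=> p.
apply: (@continuous_comp _ _ _ (fun p : T * X * N => (p.1, val p.2)) phi);
  last exact: pds_continuous.
apply: (@cvg_pair _ _ _ _ (nbhs p.1) (nbhs (val p.2)) _ _ _ fst (val \o snd)).
  exact: cvg_fst.
apply: continuous_comp; first exact: cvg_snd.
exact: initial_continuous.
Qed.

Definition pds_restrict X Lam (phi : pds R k X Lam) (N : set Lam) :
    pds R k X N :=
  Pds (@pds_restrict_continuous X Lam phi N)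
    (fun l => pds_dynsys phi (val l)).

Fact pds_const_continuous X Lam (phi : dynsys R k X) :
  continuous (fun p : T * X * Lam => phi p.1).
Proof.
move=> p; apply: continuous_comp; first exact: cvg_fst.
by have [c _ _] := dynP phi; exact: c.
Qed.

Definition pds_const X Lam (phi : dynsys R k X) : pds R k X Lam :=
  Pds (@pds_const_continuous X Lam phi) (fun _ => dynP phi).

Definition homeomorphism X Y (h : X -> Y) :=
  continuous h /\
  exists g : Y -> X, [/\ continuous g, cancel h g & cancel g h].

Definition component_indexing X (I : Type) (C : I -> set X) :=
  injective C /\ range C = range (connected_component [set: X]).

Definition conjugate X Y Lam (phi : pds R k X Lam) (psi : pds R k Y Lam) :=
  exists (h : Lam * X -> Y) (tau : Lam * T * X -> T),
    [/\ continuous h, continuous tau,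
      forall l,
        homeomorphism (fun x => h (l, x)) /\
        forall x, [/\ tau (l, time0 R k, x) = time0 R k,
          forall s t,
            val s < val t -> val (tau (l, s, x)) < val (tau (l, t, x)),
          bijective (fun t => tau (l, t, x)) &
          forall t, h (l, phi (t, x, l)) = psi (tau (l, t, x), h (l, x), l)] &
      exists (I : Type) (C : I -> set X) (D : I -> set Y),
        [/\ component_indexing C, component_indexing D &
          forall l i, (fun x => h (l, x)) @` C i = D i]].

Definition stable_at X Lam (phi : pds R k X Lam) (l0 : Lam) :=
  exists N : set Lam, [/\ open N, N l0 &
    conjugate (pds_restrict phi N) (pds_const N (pds_at phi l0))].

Definition stable X Lam (phi : pds R k X Lam) := forall l, stable_at phi l.

End Stability.

Section AttractorSections.
Context (R : realType) (k : time_kind) (X : compactMetricType R).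
Context (Lam : topologicalType) (phi : pds R k X Lam).

Definition is_attsec (U : opens Lam) (A : U -> set X) :=
  (forall l : U, attractor (pds_at phi (val l)) (A l)) /\
  forall m : U, exists (V : opens Lam) (W : set X),
    [/\ V `<=` U, oset V (val m) &
      forall l : U, oset V (val l) ->
        anbhd (pds_at phi (val l)) W /\ A l = omega (pds_at phi (val l)) W].

End AttractorSections.

Definition attsec (R : realType) (k : time_kind) (X : compactMetricType R)
    (Lam : topologicalType) (phi : pds R k X Lam) (U : opens Lam) : Type :=
  set_type (@is_attsec R k X Lam phi U).

HB.instance Definition _ (R : realType) (k : time_kind)
    (X : compactMetricType R) (Lam : topologicalType) (phi : pds R k X Lam)
    (U : opens Lam) := Choice.on (attsec phi U).

Definition secval (R : realType) (k : time_kind) (X : compactMetricType R)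
  (Lam : topologicalType) (phi : pds R k X Lam) (U : opens Lam)
  (A : attsec phi U) : U -> set X := val A.
Coercion secval : attsec >-> Funclass.

Section AttractorLattice.
Context (R : realType) (k : time_kind) (X : compactMetricType R).
Context (Lam : topologicalType) (phi : pds R k X Lam) (U : opens Lam).
Local Notation S := (attsec phi U).
Implicit Types (A B C : S) (l : U).

Lemma attsecP A B : (forall l, A l = B l) -> A = B.
Proof. by move=> AB; apply/val_inj/funext. Qed.

Lemma attsec_loc A (m : U) : exists (V : opens Lam) (W : set X),
  [/\ V `<=` U, oset V (val m) &
    forall l : U, oset V (val l) ->
      anbhd (pds_at phi (val l)) W /\ A l = omega (pds_at phi (val l)) W].
Proof. by have [_] := set_valP A; exact. Qed.

Lemma attsec_nbhd A l : exists2 W, anbhd (pds_at phi (val l)) W &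
  A l = omega (pds_at phi (val l)) W.
Proof. by have [V [W [_ Vl /(_ l Vl)[]]]] := attsec_loc A l; exists W. Qed.

Fact attsec_intro (A : U -> set X) :
  (forall m : U, exists (V : opens Lam) (W : set X),
    [/\ V `<=` U, oset V (val m) &
      forall l : U, oset V (val l) ->
        anbhd (pds_at phi (val l)) W /\ A l = omega (pds_at phi (val l)) W]) ->
  is_attsec phi A.
Proof.
move=> h; split=> // l; have [V [W [_ Vl /(_ l Vl)[aW ->]]]] := h l.
by exists W.
Qed.

Fact attsecI_subproof A B :
  is_attsec phi (fun l => omega (pds_at phi (val l)) (A l `&` B l)).
Proof.
apply: attsec_intro => m.
have [V [W [VU Vm e]]] := attsec_loc A m.
have [V' [W' [V'U V'm e']]] := attsec_loc B m.
exists (opensI V V'), (W `&` W'); split=> //.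
  exact: subset_trans (@opensIl _ V V') VU.
move=> l [/e[aW ->] /e'[aW' ->]].
by split; [exact: anbhdI|exact: omega_capE].
Qed.

Fact attsecU_subproof A B : is_attsec phi (fun l => A l `|` B l).
Proof.
apply: attsec_intro => m.
have [V [W [VU Vm e]]] := attsec_loc A m.
have [V' [W' [V'U V'm e']]] := attsec_loc B m.
exists (opensI V V'), (W `|` W'); split=> //.
  exact: subset_trans (@opensIl _ V V') VU.
move=> l [/e[aW ->] /e'[aW' ->]].
by split; [exact: anbhdU|rewrite omegaU].
Qed.

Fact attsec0_subproof : is_attsec phi (fun _ : U => set0).
Proof.
apply: attsec_intro => m; exists U, set0; split=> //; first exact: set_valP.
by move=> l _; split; [exact: anbhd0|rewrite omega0].
Qed.

Fact attsec1_subproof :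
  is_attsec phi (fun l : U => omega (pds_at phi (val l)) [set: X]).
Proof.
apply: attsec_intro => m; exists U, setT; split=> //; first exact: set_valP.
by move=> l _; split; first exact: anbhdT.
Qed.

Definition attsec_of (A : U -> set X) (hA : is_attsec phi A) : S :=
  exist _ A (mem_set hA).

(* Pointwise, the meet of attractors is the omega-limit set of the
   intersection and the join is the union. *)
Definition attsecI A B : S := attsec_of (attsecI_subproof A B).
Definition attsecU A B : S := attsec_of (attsecU_subproof A B).
Definition attsec0 : S := attsec_of attsec0_subproof.
Definition attsec1 : S := attsec_of attsec1_subproof.
Lemma attsecIE A B (l : U) :
  attsecI A B l = omega (pds_at phi (val l)) (A l `&` B l).
Proof. by []. Qed.
Lemma attsecUE A B (l : U) : attsecU A B l = A l `|` B l.
Proof. by []. Qed.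

Definition attsec_le A B : bool := `[< forall l, A l `<=` B l >].
Definition attsec_lt A B : bool := (B != A) && attsec_le A B.

Lemma omega_attsec A l : omega (pds_at phi (val l)) (A l) = A l.
Proof. by have [W aW ->] := attsec_nbhd A l; exact: omega_idem. Qed.

Fact attsec_le_def A B : attsec_le A B = (attsecI A B == A).
Proof.
apply/asboolP/eqP => [AB|<- l].
  apply: attsecP => l; rewrite -[RHS]omega_attsec; congr (omega _ _).
  exact/setIidl.
rewrite -[X in _ `<=` X]omega_attsec; apply: omega_mono; exact: subIsetr.
Qed.

Fact attsecIC : commutative attsecI.
Proof. by move=> A B; apply: attsecP => l; congr (omega _ _); exact: setIC. Qed.
Fact attsecUC : commutative attsecU.
Proof. by move=> A B; apply: attsecP => l; exact: setUC. Qed.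
Fact attsecIA : associative attsecI.
Proof.
move=> A B C; apply: attsecP => l; rewrite !attsecIE.
have [W aW ->] := attsec_nbhd A l; have [W' aW' ->] := attsec_nbhd B l.
have [W'' aW'' ->] := attsec_nbhd C l.
have [aI aI'] := (anbhdI aW aW', anbhdI aW' aW'').
by rewrite (omega_capE aW' aW'') (omega_capE aW aI') (omega_capE aW aW')
  (omega_capE aI aW'') setIA.
Qed.
Fact attsecUA : associative attsecU.
Proof. by move=> A B C; apply: attsecP => l; exact: setUA. Qed.
Fact attsecUKI B A : attsecI A (attsecU A B) = A.
Proof.
apply: attsecP => l; rewrite -[RHS]omega_attsec; congr (omega _ _).
by apply: setIidl; exact: subsetUl.
Qed.
Fact attsecIKU B A : attsecU A (attsecI A B) = A.
Proof.
apply: attsecP => l; apply/setUidl.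
rewrite -[X in _ `<=` X]omega_attsec; apply: omega_mono; exact: subIsetl.
Qed.
Fact attsecIUl : left_distributive attsecI attsecU.
Proof.
move=> A B C; apply: attsecP => l; rewrite !(attsecIE, attsecUE) -omegaU.
by congr (omega _ _); exact: setIUl.
Qed.
Fact attsecIxx : idempotent_op attsecI.
Proof.
move=> A; apply: attsecP => l; rewrite -[RHS]omega_attsec; congr (omega _ _).
exact: setIid.
Qed.

Fact attsec_display : Order.disp_t. Proof. exact: (Order.Disp tt tt). Qed.

HB.instance Definition _ := Order.isMeetJoinDistrLattice.Build attsec_display S
  attsec_le_def (fun _ _ => erefl) attsecIC attsecUC attsecIA attsecUA
  attsecUKI attsecIKU attsecIUl attsecIxx.

Fact attsec0x A : attsec_le attsec0 A.
Proof. by apply/asboolP => l; exact: sub0set. Qed.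
Fact attsecx1 A : attsec_le A attsec1.
Proof.
by apply/asboolP => l; rewrite -omega_attsec; exact: omega_mono.
Qed.
HB.instance Definition _ := Order.hasBottom.Build attsec_display S attsec0x.
HB.instance Definition _ := Order.hasTop.Build attsec_display S attsecx1.

End AttractorLattice.

Section AttractorRestriction.
Context (R : realType) (k : time_kind) (X : compactMetricType R).
Context (Lam : topologicalType) (phi : pds R k X Lam).
Context (U V : opens Lam) (VU : V `<=` U).

Fact attsec_res_subproof (A : attsec phi U) :
  is_attsec phi (fun l : V => A (incl VU l)).
Proof.
apply: attsec_intro => m.
have [W [D [WU Wm e]]] := attsec_loc A (incl VU m).
exists (opensI W V), D; split=> [|//|l [Wl _]]; first exact: opensIr.
  by split=> //; exact: set_valP.
exact: (e (incl VU l)).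
Qed.

Definition attsec_res (A : attsec phi U) : attsec phi V :=
  attsec_of (attsec_res_subproof A).

Fact attsec_res_le : {homo attsec_res : A B / (A <= B)%O}.
Proof. by move=> A B /asboolP AB; apply/asboolP => l; exact: AB. Qed.
Fact attsec_resI : Order.meet_morphism attsec_res.
Proof. by move=> A B; apply: attsecP. Qed.
Fact attsec_resU : Order.join_morphism attsec_res.
Proof. by move=> A B; apply: attsecP. Qed.
Fact attsec_res0 : attsec_res \bot%O = \bot%O.
Proof. by apply: attsecP. Qed.
Fact attsec_res1 : attsec_res \top%O = \top%O.
Proof. by apply: attsecP. Qed.

HB.instance Definition _ :=
  Order.isOrderMorphism.Build _ _ _ _ attsec_res attsec_res_le.
HB.instance Definition _ :=
  Order.isMeetLatticeMorphism.Build _ _ _ _ attsec_res attsec_resI.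
HB.instance Definition _ :=
  Order.isJoinLatticeMorphism.Build _ _ _ _ attsec_res attsec_resU.
HB.instance Definition _ :=
  Order.isBLatticeMorphism.Build _ _ _ _ attsec_res attsec_res0.
HB.instance Definition _ :=
  Order.isTLatticeMorphism.Build _ _ _ _ attsec_res attsec_res1.

End AttractorRestriction.

Section AttractorSheaves.
Context (R : realType) (k : time_kind) (X : compactMetricType R).
Context (Lam : topologicalType) (phi : pds R k X Lam).

Lemma attsec_res_id (U : opens Lam) (UU : U `<=` U) :
  @attsec_res _ _ _ _ phi _ _ UU =1 id.
Proof.
move=> A; apply: attsecP => l; rewrite /attsec_res /secval /=.
by congr (sval A _); exact: val_inj.
Qed.

Lemma attsec_res_comp (U V W : opens Lam) (VU : V `<=` U) (WV : W `<=` V)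
  (WU : W `<=` U) :
  @attsec_res _ _ _ _ phi _ _ WU =1 attsec_res WV \o attsec_res VU.
Proof.
move=> A; apply: attsecP => l; rewrite /attsec_res /secval /=.
by congr (sval A _); exact: val_inj.
Qed.

Definition booleanization_presheaf : presheaf Lam :=
  @Presheaf Lam (fun U => booleanization (attsec phi U))
    (fun U V VU => booleanization_map (attsec_res VU))
    (fun U UU => booleanization_map_id (attsec_res_id UU))
    (fun U V W VU WV WU =>
       booleanization_map_comp (attsec_res_comp VU WV WU)).

Definition monoid_algebra_presheaf : presheaf Lam :=
  @Presheaf Lam (fun U => monoid_algebra (attsec phi U))
    (fun U V VU => monoid_algebra_map (attsec_res VU))
    (fun U UU => monoid_algebra_map_id (attsec_res_id UU))
    (fun U V W VU WV WU =>
       monoid_algebra_map_comp (attsec_res_comp VU WV WU)).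

Definition attractor_sheaf : sheaf Lam :=
  sheafification booleanization_presheaf.

Definition free_attractor_sheaf : sheaf Lam :=
  sheafification monoid_algebra_presheaf.

End AttractorSheaves.

(* Main.v *)
Require Import Defs.
From HB Require Import structures.
From mathcomp Require Import all_boot all_order all_algebra.
From mathcomp Require Import all_classical all_reals topology.
From mathcomp.multinomials Require monalg.
Import -(notations) monalg.

Set Implicit Arguments.
Unset Strict Implicit.
Unset Printing Implicit Defensive.

Import Order.TTheory GRing.Theory Num.Theory.
Import numFieldTopology.Exports.

Local Open Scope classical_set_scope.
Local Open Scope ring_scope.

(** Why the theorem holds.

    Fix [l0] and let [N] be an open neighborhood on which the homeomorphisms
    [h^l] conjugate [phi^l] to [psi = phi^l0].  The time change [tau] depends
    on the point, but by compactness of [X] it is bounded and unbounded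
    uniformly in the point; so [h^l] carries omega-limit sets to omega-limit
    sets and attracting neighborhoods to attracting neighborhoods
    ([image_omega], [image_anbhd]).  Hence [h^l] identifies the attractors of
    [phi^l] with those of [psi], for each single [l].

    These identifications fit together continuously.  If [U] is such that
    [h^m(U)] attracts for [psi], then so does [h^l(U)] for [l] near [m], with
    the same attractor ([attractor_continuation]): both facts follow from
    two open conditions on compact sets, which persist by the tube lemma.
    Consequently a section of attractors over an open subset of [N] is, through
    the [h^l], a locally constant function with values in the lattice of
    attractors of [psi], and every constant function is a section: [spread]
    turns an attractor of [psi] into a section over [N], [fiber] reads a section
    at a point, [fiber] is a left inverse of [spread] ([fiberK]), and near each
    point a section is spread from its value there ([locally_spread]).

    It remains to pass from lattices to rings.  Let [G] be the Booleanization
    or the monoid algebra.  Being a functor, [G] turns [spread] into a ring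
    morphism from [G] of the attractor lattice of [psi] to the sections over
    [N], injective on stalks because [fiber] gives a retraction.  It is onto
    the stalks because [G L] is generated as a ring by the image of [L], and
    for the germs of generators this is [locally_spread].  For the monoid
    algebra, generation is the expansion in monomials; for clopen subsets of
    the Priestley spectrum it is compactness of the spectrum
    ([basic_clopen_generate]).  A ring morphism that is bijective on all stalks
    over [N] trivializes the sheafification over [N]
    ([restrict_iso_const]). *)

(** * Constant sheaves and stalks *)

Lemma rmorphism_inverse (A B : comPzRingType) (f : {rmorphism A -> B}) :
  bijective f -> exists g : {rmorphism B -> A}, cancel f g /\ cancel g f.
Proof.
case=> g fK gK.
pose gZ := GRing.isZmodMorphism.Build B A g (can2_zmod_morphism fK gK).
pose gM := GRing.isMonoidMorphism.Build B A g (can2_monoid_morphism fK gK).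
pose h : {rmorphism B -> A} := HB.pack g gZ gM.
by exists h.
Qed.

Definition const_germ (T : topologicalType) (A : comPzRingType) (x : T) :
    {rmorphism const_presheaf T A (opensT T) -> stalk (const_presheaf T A) x} :=
  @germ T (const_presheaf T A) x (opensT T) I.

Lemma const_germE (T : topologicalType) (A : comPzRingType) (x : T)
  (U : opens T) (Ux : oset U x) (a : A) :
  @germ T (const_presheaf T A) x U Ux a = const_germ A x a.
Proof.
exact: (@germ_res _ (const_presheaf T A) x _ _ (@opens_subT _ U) Ux I a).
Qed.

Lemma const_germ_bij (T : topologicalType) (A : comPzRingType) (x : T) :
  bijective (const_germ A x).
Proof.
rewrite -setTT_bijective; split=> [//|a b _ _|u _].
  by move=> /germP[W [Wa [Wb [_]]]].
by have [U [Ux [a ->]]] := germW u; exists a => //=; rewrite [RHS]const_germE.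
Qed.

Section ConstantRestriction.
Context (T : topologicalType) (F : presheaf T) (D : opens T).
Context (A : comPzRingType) (c : {rmorphism A -> F D}).
Hypothesis c_bij : forall x (Dx : oset D x), bijective (germ Dx \o c).

Let inv (x : D) : {e : {rmorphism stalk F (val x) -> A} |
  cancel (germ (set_valP x) \o c) e /\ cancel e (germ (set_valP x) \o c)}.
Proof. exact/cid/rmorphism_inverse/c_bij. Qed.

Let e (x : D) := projT1 (inv x).

Let eK (x : D) (Dx : oset D (val x)) a : e x (germ Dx (c a)) = a.
Proof.
have -> : Dx = set_valP x by exact: Prop_irrelevance.
by have [h _] := projT2 (inv x); exact: h.
Qed.

Let Ke (x : D) (Dx : oset D (val x)) u : germ Dx (c (e x u)) = u.
Proof.
have -> : Dx = set_valP x by exact: Prop_irrelevance.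
by have [_ h] := projT2 (inv x); exact: h.
Qed.

Let cinv (x : D) : {k : {rmorphism stalk (const_presheaf D A) x -> A} |
  cancel (const_germ A x) k /\ cancel k (const_germ A x)}.
Proof. exact/cid/rmorphism_inverse/const_germ_bij. Qed.

Let k (x : D) := projT1 (cinv x).

Let kK x a : k x (const_germ A x a) = a.
Proof. by have [h _] := projT2 (cinv x); exact: h. Qed.

Let Kk x u : const_germ A x (k x u) = u.
Proof. by have [_ h] := projT2 (cinv x); exact: h. Qed.

Let up (V : opens D) (x : V) : opens_image V :=
  exist _ (val (val x)) (mem_set (imageP val (set_valP x))).

Let imD (V : opens D) (y : opens_image V) : oset D (val y).
Proof. by have [x _ <-] := set_valP y; exact: set_valP. Qed.

Let imV (V : opens D) (y : opens_image V) :
  oset V (exist _ (val y) (mem_set (imD y)) : D).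
Proof.
have [x Vx xy] := set_valP y.
by rewrite (_ : exist _ _ _ = x) //; apply: val_inj.
Qed.

Let down (V : opens D) (y : opens_image V) : V :=
  exist _ (exist _ (val y) (mem_set (imD y))) (mem_set (imV y)).

Let to_loc (V : opens D) (s : shsec F (opens_image V)) :
  locally_induced (F := const_presheaf D A) (U := V)
    (fun x => const_germ A (val x) (e (val x) (s (up x)))).
Proof.
move=> x; have [W [t [Wx st]]] := shsec_loc s (up x).
have Dx : oset D (val (val x)) := set_valP (val x).
pose a := e (val x) (germ Wx t).
have /germP[O [OW [OD [Ox /= ta]]]] : germ Wx t = germ Dx (c a).
  by rewrite /a (Ke (x := val x)).
have oO : open (val @^-1` O : set D) by exists O; [exact: oset_open|].
exists (Opens oO), a; split=> // y Oy; rewrite [RHS]const_germE.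
apply: congr1; rewrite (st (up y) (OW _ Oy)).
rewrite -(germ_res OW Oy) ta (germ_res OD Oy (set_valP (val y))).
exact: eK.
Qed.

Let to (V : opens D) (s : shsec F (opens_image V)) :
  shsec (const_presheaf D A) V := ShSec (to_loc s).

Let from_loc (V : opens D) (s : shsec (const_presheaf D A) V) :
  locally_induced (F := F) (U := opens_image V)
    (fun y => germ (imD y) (c (k _ (s (down y))))).
Proof.
move=> y; have [W [a [Wx sa]]] := shsec_loc s (down y).
exists (opensI (opens_image W) D), (pres F (@opensIr _ _ _) (c a)); split.
  by split; [exists (val (down y))|exact: imD].
move=> z [Wz Dz]; rewrite (germ_res _ _ Dz).
have Wz' : oset W (val (down z)).
  by case: Wz => w Ww wz; rewrite (_ : val _ = w) //; apply: val_inj.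
rewrite (sa _ Wz') [X in k _ X]const_germE kK; congr (germ _ _).
exact: Prop_irrelevance.
Qed.

Let from (V : opens D) (s : shsec (const_presheaf D A) V) :
  shsec F (opens_image V) := ShSec (from_loc s).

Let toK (V : opens D) : cancel (@to V) (@from V).
Proof.
move=> s; apply: shsecP => y /=.
by rewrite kK (Ke (x := val (down y))); exact: (@shsec_val _ _ _ s y).
Qed.

Let fromK (V : opens D) : cancel (@from V) (@to V).
Proof.
move=> s; apply: shsecP => x /=.
rewrite (eK (x := val x)) -[RHS]Kk; apply: congr1.
case: x => -[x Dx] Vx; rewrite /down /=.
move: (imD _) (imV _) => /= Dx'; move: (mem_set Dx') => {}Dx'.
have -> : Dx' = Dx by exact: Prop_irrelevance.
by move=> Vx'; congr (k _ _); exact: shsec_irr.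
Qed.

Let to_zmod (V : opens D) : zmod_morphism (@to V).
Proof. by move=> s t; apply: shsecP => x /=; rewrite !rmorphB. Qed.

Let to_monoid (V : opens D) : GRing.monoid_morphism (@to V).
Proof.
by split=> [|s t]; apply: shsecP => x /=; rewrite ?rmorphM // !rmorph1.
Qed.

(** Sections of a sheafification are functions to the stalks, so bijections
    on stalks give a bijection between all functions.  Being locally given by a
    section of [F] corresponds to being locally constant, because two sections
    of [F] with the same germ at [x] agree near [x], in particular a section
    and [c a]. *)
Lemma restrict_iso_const :
  presheaf_iso (Defs.restrict (sheafification F) D) (const_sheaf D A).
Proof.
pose toZ V := GRing.isZmodMorphism.Build _ _ (@to V) (@to_zmod V).
pose toM V := GRing.isMonoidMorphism.Build _ _ (@to V) (@to_monoid V).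
pose f V : {rmorphism shsec F (opens_image V) ->
  shsec (const_presheaf D A) V} := HB.pack (@to V) (toZ V) (toM V).
exists f; split=> [V|V W WV s].
  by exists (@from V); [exact: toK|exact: fromK].
apply: shsecP => x /=; do 2!apply: congr1.
exact: shsec_irr.
Qed.

End ConstantRestriction.

(** The subring generated by [G] is the whole of [A], in the form of an
    induction principle. *)
Definition ring_generated_by (A : comPzRingType) (G : set A) :=
  forall P : set A, P 1 -> (forall a b, P a -> P b -> P (a - b)) ->
    (forall a b, P a -> P b -> P (a * b)) -> G `<=` P -> forall a, P a.

(** The germs at [x] in the image of [c] form a subring of the stalk, so
    surjectivity on stalks needs to be tested on generators only. *)
Lemma restrict_iso_const_of_generators (T : topologicalType) (F : presheaf T)
    (D : opens T) (A : comPzRingType) (c : {rmorphism A -> F D})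
    (G : forall U : opens T, set (F U)) :
  (forall U, ring_generated_by (G U)) ->
  (forall (U : opens T) (s : F U), G U s ->
    forall x, oset U x -> oset D x ->
    exists (W : opens T) (WU : W `<=` U) (WD : W `<=` D) (a : A),
      oset W x /\ pres F WU s = pres F WD (c a)) ->
  (forall (W : opens T) (WD : W `<=` D) x, oset W x ->
     injective (pres F WD \o c)) ->
  presheaf_iso (Defs.restrict (sheafification F) D) (const_sheaf D A).
Proof.
move=> genG locG injc; apply: (@restrict_iso_const _ _ _ _ c) => x Dx.
rewrite -setTT_bijective; split=> [//|a b _ _|u _].
  move=> /= /germP[W [Wa [Wb [Wx /=]]]].
  by rewrite (Prop_irrelevance Wb Wa); exact: (injc W Wa x Wx).
have [U [Ux [s ->]]] := germW u.
apply: (genG U [set s | exists2 a, True & (germ Dx \o c) a = germ Ux s]).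
- by exists 1 => //=; rewrite !rmorph1.
- move=> {}s t [a _ as_] [b _ bt].
  by exists (a - b) => //; rewrite !rmorphB; congr (_ - _).
- move=> {}s t [a _ as_] [b _ bt].
  by exists (a * b) => //; rewrite !rmorphM; congr (_ * _).
move=> {}s /locG/(_ x Ux Dx)[W [WU [WD [a [Wx sa]]]]].
exists a => //=; apply/germP; exists W, WD, WU; split=> //=.
Qed.

Lemma locally_constant_of_nbhd (T : topologicalType) (F : sheaf T) :
  (forall x, exists D : opens T, oset D x /\
    exists A, presheaf_iso (Defs.restrict F D) (const_sheaf D A)) ->
  locally_constant F.
Proof.
move=> locF; exists {D : opens T |
  exists A, presheaf_iso (Defs.restrict F D) (const_sheaf D A)}, (@projT1 _ _).
split=> [|[D]//]; rewrite -subTset => x _.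
by have [D [Dx DA]] := locF x; exists (exist _ D DA).
Qed.
(** * The Booleanization and the monoid algebra are generated by the lattice *)

Section PriestleyGenerators.
Context d (L : tbDistrLatticeType d).

Lemma basic_clopenP (a : L) : clopen (basic_clopen a).
Proof.
split; first by apply: priestley_subbase_open; exists a; left.
by rewrite -openC; apply: priestley_subbase_open; exists a; right.
Qed.

Lemma basic_clopenT : basic_clopen (Order.top : L) = setT.
Proof.
by apply/seteqP; split=> // J _; have [_ J1 _ _ _] := set_valP J.
Qed.

Lemma basic_clopen0 : basic_clopen (Order.bottom : L) = set0.
Proof. by rewrite -subset0 => J; have [J0 _ _ _ _] := set_valP J; apply. Qed.

Lemma basic_clopen_le (a b : L) :
  (a <= b)%O -> basic_clopen a `<=` basic_clopen b.
Proof.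
by move=> ab J Ja Jb; apply: Ja; have [_ _ Jle _ _] := set_valP J;
  exact: Jle ab Jb.
Qed.

Lemma basic_clopenU (a b : L) :
  basic_clopen (Order.join a b) `<=` basic_clopen a `|` basic_clopen b.
Proof.
move=> J Jab; apply: contrapT => /not_orP[/contrapT Ja /contrapT Jb].
by apply: Jab; have [_ _ _ JU _] := set_valP J; exact: JU.
Qed.

Lemma basic_clopenI (a b : L) :
  basic_clopen a `&` basic_clopen b `<=` basic_clopen (Order.meet a b).
Proof.
by move=> J [Ja Jb]; have [_ _ _ _ JI] := set_valP J; case/JI.
Qed.

(** An ultrafilter of prime ideals converges to the set of those [a] that
    belong to almost all ideals, which is again a prime ideal. *)
Lemma spectrum_compact : compact [set: spectrum L].
Proof.
rewrite compact_ultra => F UF _.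
have FF : ProperFilter F by exact: ultra_proper.
pose J : set L := [set a | F (~` basic_clopen a)].
have pJ : prime_ideal J.
  split.
  - by rewrite /J /= basic_clopen0 setC0; exact: filterT.
  - by rewrite /J /= basic_clopenT setCT; exact: filter_not_empty.
  - move=> a b ab; apply: filterS; apply: subsetC.
    exact: basic_clopen_le.
  - move=> a b Ja Jb; rewrite /J /=.
    by apply: filterS (filterI Ja Jb); rewrite -setCU; apply: subsetC;
      exact: basic_clopenU.
  - move=> a b Jab.
    have [Fa|] := in_ultra_setVsetC (basic_clopen a) UF; last by left.
    have [Fb|] := in_ultra_setVsetC (basic_clopen b) UF; last by right.
    exfalso; apply: (@filter_not_empty _ F).
    apply: filterS (filterI (filterI Fa Fb) Jab) => K [/basic_clopenI ab nab].
    exact: nab ab.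
pose j : spectrum L := exist _ J (mem_set pJ).
exists j; split=> // B; rewrite nbhsE => -[O [[D DO <-] [A DA Aj]] OB].
apply: filterS (subset_trans (bigcup_sup DA) OB) _.
have [E EA AE] := DO _ DA; move: Aj; rewrite -AE bigcap_fset big_seq.
elim/big_ind: _ => [_|A1 A2 h1 h2 [/h1 ? /h2 ?]|A' /EA].
- exact: filterT.
- exact: filterI.
rewrite inE => -[a [|] -> h]; last exact: contrapT.
by have [//|] := in_ultra_setVsetC (basic_clopen a) UF => /h.
Qed.

(** A clopen set is a union of finite intersections of subbasic sets, and by
    compactness finitely many of them suffice.  Boolean operations are ring
    operations: the complement is [1 - a] and the intersection is [a * b]. *)
Lemma basic_clopen_generate :
  ring_generated_by (range (fun a : L => bool_of (basic_clopenP a))).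
Proof.
move=> P P1 PB PM PG b.
pose Q : set (set (spectrum L)) := [set A | exists2 b, P b & val b = A].
suff [b' Pb' bb'] : Q (val b) by rewrite (booleanP (esym bb')).
have Q1 : Q setT by exists 1.
have QC A : Q A -> Q (~` A).
  by case=> a Pa <-; exists (1 - a); [exact: PB|exact: setTYC].
have QI A B : Q A -> Q B -> Q (A `&` B).
  by case=> a Pa <- [a' Pa' <-]; exists (a * a'); [exact: PM|].
have Q0 : Q set0 by rewrite -setCT; exact: QC.
have QU A B : Q A -> Q B -> Q (A `|` B).
  by move=> QA QB; rewrite -(setCK A) -(setCK B) -setCI; apply/QC/QI; exact: QC.
have Qbasic a : Q (basic_clopen a).
  by exists (bool_of (basic_clopenP a)) => //; apply: PG; exists a.
have Qfin A : finI_from (priestley_subbase (L := L)) id A -> Q A.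
  case=> E EA <-; rewrite bigcap_fset big_seq.
  elim/big_ind: _ => // B /EA; rewrite inE => -[a [|] ->] //; exact: QC.
have [ob cb] := set_valP b; pose C : set (spectrum L) := val b.
(* Compactness is applied along the filter of the generated subsets of [C],
   directed by inclusion: eventually such a subset contains every point. *)
pose inner A A0 := [/\ Q A, A0 `<=` A & A `<=` C].
pose F : set_system (set (spectrum L)) :=
  [set N | exists A0, [/\ Q A0, A0 `<=` C & inner ^~ A0 `<=` N]].
have FF : Filter F.
  split=> [|N N' [A [QA AC AN]] [A' [QA' AC' AN']]|N N' NN' [A [QA AC AN]]].
  - by exists set0; split.
  - exists (A `|` A'); split; [exact: QU|by rewrite subUset|].
    move=> B [QB]; rewrite subUset => -[AB AB'] BC.
    by split; [exact: AN|exact: AN'].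
  - by exists A; split=> //; exact: subset_trans NN'.
have [|A0 [QA0 A0C A0N]] := iffLR (compact_near_coveringP _) spectrum_compact
    _ F (fun A x => C x -> A x) FF.
  move=> x _; have [Cx|nCx] := pselect (C x); last first.
    exists (~` C, setT); last by move=> -[y A] [/= nCy _] /nCy.
    split; last exact: filterT.
    by apply: open_nbhs_nbhs; split=> //; exact: closed_openC.
  have [D DO DE] := ob; have : C x by [].
  rewrite /C -DE => -[A DA Ax]; have AC : A `<=` C.
    by rewrite /C -DE; exact: bigcup_sup.
  exists (A, inner ^~ A).
    split; last by exists A; split=> //; exact/Qfin/DO.
    apply: open_nbhs_nbhs; split=> //; exists [set A].
      by move=> _ ->; exact: DO.
    by rewrite bigcup_set1.
  by move=> -[y A'] /= [Ay [_ AA' _]] _; exact: AA'.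
suff -> : val b = A0 by [].
apply/seteqP; split=> // x Cx.
by apply: (A0N A0); first by split.
Qed.

End PriestleyGenerators.

Lemma monomials_generate d (L : tbDistrLatticeType d) :
  ring_generated_by
    (range (fun a : meet_monoid L => mkmalgU a 1 : monoid_algebra L)).
Proof.
move=> P P1 PB PM PG u.
have P0 : P 0 by rewrite -(subrr 1); exact: PB.
have PD a b : P a -> P b -> P (a + b).
  by move=> Pa Pb; rewrite -(opprK b) -[- b]add0r; apply/PB/PB.
rewrite (monalgE u); elim/big_ind: _ => // a _.
have [->|->] : mcoeff a u = 0 \/ mcoeff a u = 1.
- by case: (mcoeff a u) => -[|[|//]] ?; [left|right]; exact: val_inj.
- by rewrite (_ : mkmalgU a 0 = 0) // ; apply: raddf0.
by apply: PG; exists a.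
Qed.
(** * Conjugacies preserve omega-limit sets *)

(** The tube lemma: an open condition on a compact set persists under small
    changes of the parameter. *)
Lemma near_forall_compact (T X : topologicalType) (Y : topologicalType)
    (f : T * X -> Y) (K : set X) (O : set Y) (t : T) :
  continuous f -> compact K -> open O -> (forall x, K x -> O (f (t, x))) ->
  \forall s \near t, forall x, K x -> O (f (s, x)).
Proof.
move=> cf /compact_near_coveringP cK oO KO.
apply: (cK T (nbhs t) (fun s x => O (f (s, x)))) => x /KO Ox.
have [[A B] /= [tA xB] AB] := cf (t, x) O (open_nbhs_nbhs (conj oO Ox)).
by exists (B, A) => // -[y s] [/= yB sA]; exact: (AB (s, y)).
Qed.

Section Times.
Context (R : realType) (k : time_kind).

Lemma time_set_nat n : time_set R k n%:R.
Proof. by case: k => /=. Qed.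

Definition time_nat n : time R k := exist _ n%:R (mem_set (time_set_nat n)).

End Times.

Section OmegaTail.
Context (R : realType) (k : time_kind) (X : compactMetricType R).
Implicit Types (phi : dynsys R k X) (U V O : set X).

(** The closed tails decrease to the omega-limit set, so by compactness one of
    them already lies in [O]. *)
Lemma omega_tail_subset phi U O : open O -> omega phi U `<=` O ->
  exists2 t : time R k, 0 <= val t & closure (tail phi U t) `<=` O.
Proof.
move=> oO UO.
have /compact_near_coveringP cX := @compact_space R X.
have [n _ nP] : \forall n \near \oo, setT `<=`
    (fun x => closure (tail phi U (time_nat R k n)) x -> O x).
  apply: cX => x _; have [Ox|nOx] := pselect (O x).
    exists (O, setT); first by split; [exact: open_nbhs_nbhs|exact: filterT].
    by move=> -[y n] [/= ? _].
  have /existsNP[t /not_implyP[/= t0 ntx]] : ~ omega phi U x by move/UO.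
  exists (~` closure (tail phi U t), [set n | val t <= n%:R]).
    split; last exact: nbhs_infty_ger.
    apply: open_nbhs_nbhs; split=> //; apply: closed_openC.
    exact: closed_closure.
  move=> -[y n] [/= nty tn] nty'; exfalso; apply: nty.
  by apply: closure_subset nty'; exact: tail_le.
exists (time_nat R k n); first exact: ler0n.
by move=> x; apply: (nP n) => /=.
Qed.

(** The orbits of [U] are, up to the time shift [t], orbits of [V], and
    omega-limit sets ignore finite times. *)
Lemma omega_image_le phi U V (t : time R k) :
  0 <= val t -> (forall x, U x -> V (phi (t, x))) ->
  omega phi U `<=` omega phi V.
Proof.
move=> t0 UV x xU s s0.
apply: closure_subset (xU (timeD t s) _); last by rewrite /= addr_ge0.
move=> y [r /= tsr [u Uu <-]].
have [w [w0 rE]] := @timeB _ _ (timeD t s) r tsr.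
exists (timeD s w); first by rewrite /= lerDl.
exists (phi (t, u)); first exact: UV.
have [_ _ D] := dynP phi; rewrite D rE; congr (phi (_, _)).
by apply: val_inj => /=; rewrite addrC addrA.
Qed.

Lemma phi_tail phi U (t : time R k) x : U x -> tail phi U t (phi (t, x)).
Proof. by move=> Ux; exists t => /=; [exact: lexx|exists x]. Qed.

End OmegaTail.

(** A conjugacy [h] with inverse [g] whose time change depends on the point. *)
Section Reparametrization.
Context (R : realType) (k : time_kind) (X : compactMetricType R).
Context (phi psi : dynsys R k X) (h g : X -> X).
Context (tau : time R k -> X -> time R k).
Hypotheses (hc : continuous h) (gc : continuous g).
Hypotheses (hK : cancel h g) (gK : cancel g h).
Hypothesis tauc : forall t, continuous (fun x => tau t x).
Hypothesis tau_mono : forall x (s t : time R k),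
  val s < val t -> val (tau s x) < val (tau t x).
Hypothesis tau_bij : forall x, bijective (fun t => tau t x).
Hypothesis htau : forall t x, h (phi (t, x)) = psi (tau t x, h x).

Let tau_le x (s t : time R k) :
  val s <= val t -> val (tau s x) <= val (tau t x).
Proof.
rewrite le_eqVlt => /predU1P[st|/(tau_mono x)/ltW//].
by rewrite (val_inj st).
Qed.

Let val_tauc t : continuous (fun x => val (tau t x) : R).
Proof.
by move=> x; apply: continuous_comp; [exact: tauc|exact: initial_continuous].
Qed.

Let compactX := iffLR (compact_near_coveringP _) (@compact_space R X).

(** This and the next lemma make the time change uniform in the point, as is
    necessary because a tail consists of the orbits of many points. *)
Lemma reparametrization_bounded (t : time R k) :
  exists2 s : time R k, 0 <= val s & forall x, val (tau t x) <= val s.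
Proof.
have [n _ nP] : \forall n \near \oo, setT `<=`
    (fun x => val (tau t x) <= n%:R).
  apply: compactX => x _.
  exists ([set y | val (tau t y) < val (tau t x) + 1],
          [set n | val (tau t x) + 1 <= n%:R]).
    split; last exact: nbhs_infty_ger.
    apply: (@val_tauc t x [set r | r < val (tau t x) + 1]).
    by apply: lt_nbhsl; rewrite ltrDl.
  by move=> -[y n] [/= yx xn]; apply: ltW; exact: lt_le_trans yx xn.
by exists (time_nat R k n) => [|x]; [exact: ler0n|exact: (nP n (leqnn n) x I)].
Qed.

Lemma reparametrization_unbounded (t : time R k) :
  exists2 s : time R k, 0 <= val s & forall x, val t <= val (tau s x).
Proof.
have [n _ nP] : \forall n \near \oo, setT `<=`
    (fun x => val t <= val (tau (time_nat R k n) x)).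
  apply: compactX => x _; have [b _ bK] := tau_bij x.
  (* A strict inequality is an open condition on the point, hence [t + 1]. *)
  pose s := b (timeD t (time_nat R k 1)).
  exists ([set y | val t < val (tau s y)], [set n | val s <= n%:R]).
    split; last exact: nbhs_infty_ger.
    apply: (@val_tauc s x [set r | val t < r]).
    by apply: lt_nbhsr; rewrite bK /= ltrDl.
  move=> -[y n] [/= ty sn]; apply: le_trans (ltW ty) _; exact: tau_le.
by exists (time_nat R k n) => [|x]; [exact: ler0n|exact: (nP n (leqnn n) x I)].
Qed.

Lemma image_closure_homeo (U : set X) : h @` closure U = closure (h @` U).
Proof.
apply/seteqP; split=> [_ [x Ux <-]|y Uy].
  move=> B /hc/Ux[z [Uz Bz]]; exists (h z); split=> //; exact: imageP.
exists (g y) => // B gyB.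
have [|z [[x Ux xz] Bz]] := Uy (g @^-1` B).
  exact: gc.
by exists x; split=> //; rewrite -(hK x) xz.
Qed.

Lemma image_interior_homeo (U : set X) : h @` interior U = interior (h @` U).
Proof.
apply/seteqP; split=> [_ [x Ux <-]|y Uy].
  have : nbhs (h x) (g @^-1` U) by apply: gc; rewrite hK.
  by apply: filterS => z Uz; exists (g z).
exists (g y) => //.
have : nbhs (g y) (h @^-1` (h @` U)) by apply: hc; rewrite gK.
by apply: filterS => z [x Ux] /(can_inj hK) <-.
Qed.

(** The image of each tail of [phi] contains a tail of [psi] and is contained
    in one, so both families have the same intersection of closures. *)
Lemma image_omega (U : set X) : h @` omega phi U = omega psi (h @` U).
Proof.
apply/seteqP; split=> [_ [x xU <-] t t0|y yU].
  have [s s0 sP] := reparametrization_unbounded t.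
  have : (h @` closure (tail phi U s)) (h x) by exists x => //; exact: xU.
  rewrite image_closure_homeo; apply: closure_subset.
  move=> _ [_ [r /= sr [u Uu <-]] <-]; rewrite htau.
  exists (tau r u); last by exists (h u).
  by apply: le_trans (sP u) _; exact: tau_le.
exists (g y) => // t t0; have [s s0 sP] := reparametrization_bounded t.
suff [x tx <-] : (h @` closure (tail phi U t)) y by rewrite hK.
rewrite image_closure_homeo; apply: closure_subset (yU s s0).
move=> _ [r /= sr [_ [u Uu <-] <-]].
have [b _ bK] := tau_bij u; exists (phi (b r, u)); last by rewrite htau bK.
exists (b r); last by exists u.
rewrite /= leNgt; apply/negP => /(tau_mono u); rewrite bK.
by apply/negP; rewrite -leNgt; exact: le_trans (sP u) sr.
Qed.

Lemma image_anbhd (U : set X) : anbhd phi U <-> anbhd psi (h @` U).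
Proof.
rewrite /anbhd /= -image_omega -image_interior_homeo; split.
  exact: image_subset.
by move=> UU x /(imageP h)/UU[y Uy] /(can_inj hK) <-.
Qed.

End Reparametrization.
(** * The lattice of attractors of one system *)

Fact meet_morphism_le d (L : tbDistrLatticeType d) d'
    (M : tbDistrLatticeType d') (f : L -> M) :
  Order.meet_morphism f -> {homo f : a b / (a <= b)%O}.
Proof. by move=> fI a b; rewrite !leEmeet -fI => /eqP->. Qed.

Definition bdlmorphism_of d (L : tbDistrLatticeType d) d'
    (M : tbDistrLatticeType d') (f : L -> M) (fI : Order.meet_morphism f)
    (fU : Order.join_morphism f) (f0 : f \bot%O = \bot%O)
    (f1 : f \top%O = \top%O) : {bdlmorphism L -> M} :=
  HB.pack f (Order.isOrderMorphism.Build _ _ _ _ f (meet_morphism_le fI))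
    (Order.isMeetLatticeMorphism.Build _ _ _ _ f fI)
    (Order.isJoinLatticeMorphism.Build _ _ _ _ f fU)
    (Order.isBLatticeMorphism.Build _ _ _ _ f f0)
    (Order.isTLatticeMorphism.Build _ _ _ _ f f1).

HB.instance Definition _ := hasNbhs.Build unit principal_filter.
HB.instance Definition _ := Discrete_ofNbhs.Build unit erefl.

Section AttractorLattice.
Context (R : realType) (k : time_kind) (X : compactMetricType R).
Context (psi : dynsys R k X).

(** Taking sections over a one-point parameter space gives the attractors of
    [psi] with the same lattice operations as in the sheaf. *)
Definition att_lattice : tbDistrLatticeType attsec_display :=
  attsec (pds_const unit psi) (opensT unit).

Definition att_set (B : att_lattice) : set X :=
  secval (B : attsec (pds_const unit psi) (opensT unit))
    (exist _ tt (mem_set I)).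

Lemma att_setP (B B' : att_lattice) : att_set B = att_set B' -> B = B'.
Proof.
move=> BB'; apply: attsecP => -[[] p].
by have -> : p = mem_set I by exact: Prop_irrelevance.
Qed.

Lemma att_set_nbhd (B : att_lattice) :
  exists2 U, anbhd psi U & att_set B = omega psi U.
Proof.
exact: (@attsec_nbhd _ _ _ _ (pds_const unit psi) (opensT unit) B
  (exist _ tt (mem_set I))).
Qed.

Lemma is_attsec_omega U : anbhd psi U ->
  is_attsec (pds_const unit psi) (fun _ : opensT unit => omega psi U).
Proof.
move=> aU; apply: attsec_intro => m; exists (opensT unit), U.
by split=> //; exact: subset_refl.
Qed.

End AttractorLattice.

(** * Functors from lattices to rings *)

Local Notation attLattice := (tbDistrLatticeType attsec_display).

(** The Booleanization and the monoid algebra enter the argument only through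
    functoriality and the generation of the ring by the lattice. *)
Record generated_functor := GeneratedFunctor {
  gf_ring :> attLattice -> comPzRingType;
  gf_map : forall L M : attLattice,
    {bdlmorphism L -> M} -> {rmorphism gf_ring L -> gf_ring M};
  gf_map_id : forall (L : attLattice) (f : {bdlmorphism L -> L}),
    f =1 id -> forall u, gf_map f u = u;
  gf_map_comp : forall (L M N : attLattice) (f : {bdlmorphism L -> M})
    (f' : {bdlmorphism M -> N}) (f'' : {bdlmorphism L -> N}),
    f'' =1 f' \o f -> forall u, gf_map f' (gf_map f u) = gf_map f'' u;
  gf_gen : forall L : attLattice, L -> gf_ring L;
  gf_map_gen : forall (L M : attLattice) (f : {bdlmorphism L -> M}) a,
    gf_map f (gf_gen a) = gf_gen (f a);
  gf_generate : forall L : attLattice, ring_generated_by (range (@gf_gen L)) }.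

Lemma booleanization_map_basic d (L : tbDistrLatticeType d) d'
    (M : tbDistrLatticeType d') (f : {bdlmorphism L -> M}) (a : L) :
  booleanization_map f (bool_of (basic_clopenP a)) =
  bool_of (basic_clopenP (f a)).
Proof. exact: booleanP. Qed.

Definition booleanization_functor : generated_functor :=
  @GeneratedFunctor (fun L => booleanization L)
    (fun L M f => booleanization_map f)
    (fun L => @booleanization_map_id _ L)
    (fun L M N => @booleanization_map_comp _ L _ M _ N)
    (fun L a => bool_of (basic_clopenP a))
    (fun L M f => booleanization_map_basic f)
    (fun L => @basic_clopen_generate _ L).

Definition monoid_algebra_functor : generated_functor :=
  @GeneratedFunctor (fun L => monoid_algebra L)
    (fun L M f => monoid_algebra_map f)
    (fun L => @monoid_algebra_map_id _ L)
    (fun L M N => @monoid_algebra_map_comp _ L _ M _ N)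
    (fun L a => mkmalgU (a : meet_monoid L) 1)
    (fun L M f a => monoid_algebra_mapU f a 1)
    (fun L => @monomials_generate _ L).

Definition functor_presheaf (G : generated_functor) (R : realType)
    (k : time_kind) (X : compactMetricType R) (Lam : topologicalType)
    (phi : pds R k X Lam) : presheaf Lam :=
  @Presheaf Lam (fun U => G (attsec phi U))
    (fun U V VU => gf_map G (attsec_res VU))
    (fun U UU => gf_map_id (attsec_res_id UU))
    (fun U V W VU WV WU => gf_map_comp (attsec_res_comp VU WV WU)).

(** * Trivialization of the sheaf of attractors along a conjugacy *)

Lemma nbhs_subspace_open (T : topologicalType) (D : opens T) (m : D)
    (P : set D) :
  nbhs m P -> exists V : opens T, [/\ V `<=` D, oset V (val m) &
    forall l : D, oset V (val l) -> P l].
Proof.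
rewrite nbhsE => -[O [[B oB BO] Om] OP].
exists (opensI (Opens oB) D); split; first exact: opensIr.
  by rewrite -BO in Om; split=> //; exact: set_valP.
by move=> l [Bl _]; apply: OP; rewrite -BO.
Qed.

(** The maps [h^l] are given with their inverses [g l], and [psi] is the
    system to which they conjugate; only their effect on omega-limit sets and
    attracting neighborhoods matters from here on. *)
Section Trivialization.
Context (R : realType) (k : time_kind) (X : compactMetricType R).
Context (Lam : topologicalType) (phi : pds R k X Lam) (D : opens Lam).
Context (psi : dynsys R k X) (h : D * X -> X) (g : D -> X -> X).
Hypotheses (hc : continuous h) (gc : forall l, continuous (g l)).
Hypothesis hK : forall l, cancel (fun x => h (l, x)) (g l).
Hypothesis gK : forall l, cancel (g l) (fun x => h (l, x)).
Local Notation hh l := (fun x => h (l, x)).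
Local Notation phi_ l := (pds_at phi (val l)).
Hypothesis h_omega : forall (l : D) U,
  hh l @` omega (phi_ l) U = omega psi (hh l @` U).
Hypothesis h_anbhd : forall (l : D) U,
  anbhd (phi_ l) U <-> anbhd psi (hh l @` U).

Let hcl l : continuous (hh l).
Proof.
move=> x; apply: (@continuous_comp _ _ _ (fun x => (l, x)) h); last exact: hc.
by apply: (@cvg_pair _ _ _ (nbhs x) (nbhs l) (nbhs x) _ _ _ (fun=> l) id);
  [exact: cvg_cst|exact: cvg_id].
Qed.

Let himK l (U : set X) : hh l @` (hh l @^-1` U) = U.
Proof.
apply/seteqP; split=> [_ [x Ux <-]//|y Uy].
by exists (g l y); rewrite /= gK.
Qed.

Let hpreK l (U : set X) : hh l @^-1` (hh l @` U) = U.
Proof.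
apply/seteqP; split=> [x [y Uy] /(can_inj (@hK l)) <- //|x Ux].
by exists x.
Qed.

Let preimage_omega_h l (U : set X) :
  hh l @^-1` omega psi U = omega (phi_ l) (hh l @^-1` U).
Proof. by rewrite -{1}(himK l U) -h_omega hpreK. Qed.

Let preimage_g l (U : set X) : g l @^-1` U = hh l @` U.
Proof.
apply/seteqP; split=> [x Ux|_ [x Ux <-]]; last by rewrite /= hK.
by exists (g l x) => //; rewrite gK.
Qed.

Let preimage_omega_g l (U : set X) :
  g l @^-1` omega (phi_ l) U = omega psi (g l @^-1` U).
Proof. by rewrite !preimage_g h_omega. Qed.

(** Let [W] be a closed tail of [h^m(U)] inside the interior of [h^m(U)].  For
    [l] near [m], the time-[t] map, with [t] the time of the tail, sends
    [h^l(U)] into [h^m(U)], and [W] stays inside the interior of [h^l(U)]; hence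
    each of the two sets flows into the other in finite time. *)
Lemma attractor_continuation (m : D) (U : set X) : anbhd psi (hh m @` U) ->
  \forall l \near m, anbhd psi (hh l @` U) /\
    omega psi (hh l @` U) = omega psi (hh m @` U).
Proof.
move=> aU; pose O := interior (hh m @` U).
have oO : open O by exact: open_interior.
have [t t0 tO] := omega_tail_subset oO aU.
pose W := closure (tail psi (hh m @` U) t).
have compactX (K : set X) : closed K -> compact K.
  by move=> cK; apply: (subclosed_compact cK compact_space).
have near_in : \forall l \near m,
    forall x, closure U x -> O (psi (t, h (l, x))).
  apply: (near_forall_compact (f := fun p => psi (t, h p))) => //.
  - move=> p; apply: (@continuous_comp _ _ _ h (fun x => psi (t, x))).
      exact: hc.
    exact: dyn_continuous.
  - exact/compactX/closed_closure.
  - move=> x Ux; apply: tO => B /(@dyn_continuous _ _ _ psi t)/(@hcl m)/Ux.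
    move=> [y [Uy By]]; exists (psi (t, h (m, y))); split=> //.
    exact/phi_tail/imageP.
(* [W] lies in the interior of [h^l(U)] when the image of the complement of the
   interior of [U], a compact set, avoids [W]. *)
have near_out : \forall l \near m,
    forall x, (~` interior U) x -> (~` W) (h (l, x)).
  apply: near_forall_compact => //.
  - by apply/compactX/open_closedC; exact: open_interior.
  - exact/closed_openC/closed_closure.
  - move=> x nUx /tO; rewrite /O.
    rewrite -(image_interior_homeo (@hcl m) (@gc m) (@hK m) (@gK m)).
    by move=> [y Uy] /(can_inj (@hK m)) yx; apply: nUx; rewrite -yx.
apply: filterS2 near_in near_out => l l_in l_out.
have WU : W `<=` interior (hh l @` U).
  rewrite -(image_interior_homeo (@hcl l) (@gc l) (@hK l) (@gK l)) => w Ww.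
  exists (g l w); last exact: gK.
  apply: contrapT => nU.
  by apply: (l_out _ nU); rewrite gK.
have le1 : omega psi (hh l @` U) `<=` omega psi (hh m @` U).
  apply: (omega_image_le t0) => _ [x Ux <-]; apply: interior_subset.
  by apply: l_in; exact: subset_closure.
split.
  by move=> x /le1/(_ t t0); exact: WU.
apply/seteqP; split=> //; apply: (omega_image_le t0) => x Ux.
apply: interior_subset; apply: WU; apply: subset_closure.
exact: phi_tail.
Qed.

(** If [U] attracts for [psi], the neighborhood that witnesses local constancy
    near [m] is the preimage of [U] under [h^m], which by continuation serves
    all nearby parameters. *)
Fact spread_subproof (B : att_lattice psi) :
  is_attsec phi (fun l : D => hh l @^-1` att_set B).
Proof.
apply: attsec_intro => m; have [U aU ->] := att_set_nbhd B.
have mU := himK m U; rewrite -mU in aU *.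
have [V [VD Vm Vc]] := nbhs_subspace_open (attractor_continuation aU).
exists V, (hh m @^-1` U); split=> // l /Vc[al <-].
by split; [exact/h_anbhd|rewrite preimage_omega_h hpreK].
Qed.

Definition spread_fun (B : att_lattice psi) : attsec phi D :=
  attsec_of (spread_subproof B).

Definition spread : {bdlmorphism att_lattice psi -> attsec phi D}.
Proof.
apply: (@bdlmorphism_of _ _ _ _ spread_fun) => [B B'|B B'||].
- by apply: attsecP => l; exact: preimage_omega_h.
- exact: attsecP.
- exact: attsecP.
- by apply: attsecP => l; exact: (preimage_omega_h l setT).
Defined.

Lemma spreadE B : spread B = spread_fun B.
Proof. reflexivity. Qed.

Section Fiber.
Context (x : D) (U : opens Lam) (Ux : oset U (val x)).
Let xU : U := exist _ (val x) (mem_set Ux).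

Fact fiber_subproof (A : attsec phi U) :
  is_attsec (pds_const unit psi) (fun _ : opensT unit => g x @^-1` A xU).
Proof.
have [W aW ->] := attsec_nbhd A xU.
rewrite preimage_omega_g; apply: is_attsec_omega.
by rewrite preimage_g; exact/h_anbhd.
Qed.

(** The value of a section at [x], moved to [psi] by [h^x]; it is written as a
    preimage under the inverse map since preimages commute definitionally with
    the lattice operations on sets. *)
Definition fiber_fun (A : attsec phi U) : att_lattice psi :=
  attsec_of (fiber_subproof A).

Definition fiber : {bdlmorphism attsec phi U -> att_lattice psi}.
Proof.
apply: (@bdlmorphism_of _ _ _ _ fiber_fun) => [A A'|A A'||].
- by apply: att_setP; exact: preimage_omega_g.
- exact: att_setP.
- exact: att_setP.
- by apply: att_setP; exact: (preimage_omega_g x setT).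
Defined.

Lemma fiberE A : fiber A = fiber_fun A.
Proof. reflexivity. Qed.

(** Near [x] the section is the attractor of a fixed [E]; continuation says
    that [h^l] takes it to the same attractor of [psi] for all [l] near [x]. *)
Lemma locally_spread (A : attsec phi U) :
  exists (W : opens Lam) (WU : W `<=` U) (WD : W `<=` D),
    oset W (val x) /\ attsec_res WU A = attsec_res WD (spread (fiber A)).
Proof.
have [V [E [VU Vx VA]]] := attsec_loc A xU.
have [aE xE] := VA xU Vx.
have [V' [V'D V'x Vc]] :=
  nbhs_subspace_open (attractor_continuation (iffLR (h_anbhd _ _) aE)).
exists (opensI V V'), (subset_trans (@opensIl _ V V') VU),
  (subset_trans (@opensIr _ V V') V'D); split=> //.
apply: attsecP => l; have [Vl V'l] := set_valP l.
pose lU := Defs.incl (subset_trans (@opensIl _ V V') VU) l.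
pose lD := Defs.incl (subset_trans (@opensIr _ V V') V'D) l.
rewrite [LHS](_ : _ = omega (phi_ lU) E); last by have [] := VA lU Vl.
rewrite [RHS](_ : _ = hh lD @^-1` (g x @^-1` A xU)); last exact: erefl.
have [_ lx] := Vc lD V'l.
by rewrite xE preimage_g h_omega -lx preimage_omega_h hpreK.
Qed.

End Fiber.

Lemma fiberK (x : D) (Dx : oset D (val x)) : cancel spread (fiber Dx).
Proof.
move=> B; apply: att_setP; apply/funext => y.
transitivity (att_set B (h (x, g x y))); last by rewrite gK.
have xE : exist _ (val x) (mem_set Dx) = x by exact: val_inj.
by rewrite spreadE fiberE /att_set /secval /= xE.
Qed.

Lemma fiber_res (x : D) (U V : opens Lam) (VU : V `<=` U)
  (Ux : oset U (val x)) (Vx : oset V (val x)) :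
  fiber Ux =1 fiber Vx \o attsec_res VU.
Proof.
move=> A; apply: att_setP; rewrite [LHS](_ : _ = g x @^-1` secval A
  (exist _ (val x) (mem_set Ux))) //.
rewrite [RHS](_ : _ = g x @^-1` secval A
  (Defs.incl VU (exist _ (val x) (mem_set Vx)))) //.
by congr (g x @^-1` secval A _); exact: val_inj.
Qed.

Lemma functor_presheaf_iso_const (G : generated_functor) :
  presheaf_iso (Defs.restrict (sheafification (functor_presheaf G phi)) D)
    (const_sheaf D (G (att_lattice psi))).
Proof.
apply: (@restrict_iso_const_of_generators _ (functor_presheaf G phi) D _
  (gf_map G spread) (fun U => range (@gf_gen G (attsec phi U)))).
- by move=> U; exact: gf_generate.
- move=> U _ [A _ <-] x Ux Dx.
  pose y : D := exist _ x (mem_set Dx).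
  have [W [WU [WD [Wx WA]]]] := @locally_spread y U Ux A.
  exists W, WU, WD, (gf_gen G (fiber (x := y) Ux A)); split=> //=.
  rewrite !gf_map_gen; congr gf_gen; exact: WA.
- move=> W WD x Wx; pose y : D := exist _ x (mem_set (WD _ Wx)).
  apply: (can_inj (g := gf_map G (fiber (x := y) Wx))) => u /=.
  rewrite (gf_map_comp (@fiber_res y D W WD (WD _ Wx) Wx)).
  have idI : Order.meet_morphism (@id (att_lattice psi)) by [].
  have idU : Order.join_morphism (@id (att_lattice psi)) by [].
  rewrite (@gf_map_comp G _ _ _ _ _ (bdlmorphism_of idI idU erefl erefl)).
    exact: gf_map_id.
  by move=> B; exact/esym/(@fiberK y (WD _ Wx)).
Qed.

End Trivialization.

(** * Stable parametrizations *)

Section StableAt.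
Context (R : realType) (k : time_kind) (X : compactMetricType R).
Context (Lam : topologicalType) (phi : pds R k X Lam).

Lemma functor_sheaf_locally_constant (G : generated_functor) :
  stable phi -> locally_constant (sheafification (functor_presheaf G phi)).
Proof.
move=> st; apply: locally_constant_of_nbhd => l0.
have [N [oN Nl0 [h [tau [hc tauc hP _]]]]] := st l0.
pose D := Opens oN; exists D; split=> //.
exists (G (att_lattice (pds_at phi l0))).
have /choice[g gP] : forall l : D, exists g : X -> X,
    [/\ continuous g, cancel (fun x => h (l, x)) g &
      cancel g (fun x => h (l, x))].
  by move=> l; have [[_ ?] _] := hP l.
have homeo l := (hP l).1.1.
have taulc (l : D) t : continuous (fun x => tau (l, t, x)).
  move=> x; apply: (@continuous_comp _ _ _ (fun x => (l, t, x)) tau);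
    last exact: tauc.
  by apply: (@cvg_pair _ _ _ (nbhs x) (nbhs (l, t)) (nbhs x) _ _ _
    (fun=> (l, t)) id); [exact: cvg_cst|exact: cvg_id].
have h_conj (l : D) U :
    (fun x => h (l, x)) @` omega (pds_at phi (val l)) U =
    omega (pds_at phi l0) ((fun x => h (l, x)) @` U) /\
    (anbhd (pds_at phi (val l)) U <->
     anbhd (pds_at phi l0) ((fun x => h (l, x)) @` U)).
  have [gc hK gK] := gP l.
  have mono x (s t : time R k) : val s < val t ->
    val (tau (l, s, x)) < val (tau (l, t, x)).
    by have [_ /(_ x)[_ + _ _]] := hP l; apply.
  have bij x : bijective (fun t => tau (l, t, x)).
    by have [_ /(_ x)[_ _ + _]] := hP l.
  have htau t x : h (l, pds_at phi (val l) (t, x)) =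
      pds_at phi l0 (tau (l, t, x), h (l, x)).
    by have [_ /(_ x)[_ _ _]] := hP l; exact.
  have tc t : continuous (fun x => tau (l, t, x)) by exact: taulc.
  split.
    exact: (@image_omega _ _ _ (pds_at phi (val l)) (pds_at phi l0) _ _
      (fun t x => tau (l, t, x)) (homeo l) gc hK gK tc mono bij htau).
  exact: (@image_anbhd _ _ _ (pds_at phi (val l)) (pds_at phi l0) _ _
      (fun t x => tau (l, t, x)) (homeo l) gc hK gK tc mono bij htau).
apply: (@functor_presheaf_iso_const _ _ _ _ phi D (pds_at phi l0) h g hc
  _ _ _ _ _ G).
- by move=> l; have [] := gP l.
- by move=> l; have [] := gP l.
- by move=> l; have [] := gP l.
- by move=> l U; have [] := h_conj l U.
- by move=> l U; have [] := h_conj l U.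
Qed.

End StableAt.

Theorem lemma9p3 (R : realType) (k : time_kind) (X : compactMetricType R)
    (Lam : topologicalType) (phi : pds R k X Lam) :
  stable phi ->
  locally_constant (attractor_sheaf phi) /\
  locally_constant (free_attractor_sheaf phi).
Proof.
move=> st; split.
  exact: (functor_sheaf_locally_constant booleanization_functor st).
exact: (functor_sheaf_locally_constant monoid_algebra_functor st).
Qed.
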